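(* The triple $(\mathsf{P},\delta,\mathbb{M})$ is a monad on the whole category $\mathbf{SSS}$ of sample-smooth spaces, with no hypothesis on the objects: the assignment $\mathcal{X}\mapsto\mathsf{P}(\mathcal{X})$, $f\mapsto\mathsf{P}(f)=f_*$ is an endofunctor of $\mathbf{SSS}$, the maps $\delta_{\mathcal{X}}:\mathcal{X}\to\mathsf{P}(\mathcal{X})$ and $\mathbb{M}_{\mathcal{X}}:\mathsf{P}(\mathsf{P}(\mathcal{X}))\to\mathsf{P}(\mathcal{X})$ are morphisms of $\mathbf{SSS}$ natural in $\mathcal{X}$, and the monad laws hold. Moreover this monad is strong for the cartesian monoidal structure of $\mathbf{SSS}$ (with strength $\tau_{\mathcal{X},\mathcal{Y}}(x,\nu)=\delta_x\otimes\nu$), commutative, and affine (i.e. $\mathsf{P}(\mathbf{1})\cong\mathbf{1}$ for the one-point space $\mathbf{1}$).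
   Context: **Sample space.** $\Omega=[0,1]^{\mathbb{N}}$; $\mathcal{B}_\Omega$ is the universal completion of its Borel (product) $\sigma$-algebra, i.e. all universally measurable subsets; $\Omega^\Omega$ is the set of all $\mathcal{B}_\Omega$-$\mathcal{B}_\Omega$-measurable self-maps of $\Omega$; $\mathsf{P}_\Omega$ is the set of all probability measures on $\mathcal{B}_\Omega$; $U=\bigotimes_{n}U[0,1]$ is the uniform measure. $\Theta=(\Theta_1,\Theta_2):\Omega\to\Omega\times\Omega$ is the Borel isomorphism de-interleaving the coordinates of a sequence (e.g. even- and odd-indexed coordinates); $\Theta_*U=U\otimes U$. **Site.** $\Omega_n:=\mathbb{R}^n\times\Omega$, $n\ge0$ ($\Omega_0=\Omega$). A map $g:\Omega_m\to\mathbb{R}^n$ is mixed-smooth, $g\in\mathcal{C}^\infty_{\mathrm{mix}}(\Omega_m,\mathbb{R}^n)$, if (M1) $g(-,\omega)\in C^\infty(\mathbb{R}^m,\mathbb{R}^n)$ for every $\omega$, and (M2) $g(t,-)$ is $\mathcal{B}_\Omega$-Borel measurable for every $t$. The category $\mathbb{S}$ has objects $\Omega_n$ and morphisms $\mathbb{S}(\Omega_m,\Omega_n)=\{(g,\Phi): g\in\mathcal{C}^\infty_{\mathrm{mix}}(\Omega_m,\mathbb{R}^n),\Phi\in\Omega^\Omega\}$, where $(g,\Phi)(t,\omega)=(g(t,\omega),\Phi(\omega))$, composed as maps. **Sample-smooth spaces.** A sample-smooth space is a set $\mathcal{X}$ with, for each $n\ge0$, a set $\mathcal{X}^{\Omega_n}$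 of maps $\Omega_n\to\mathcal{X}$ (plots) containing all constant maps and such that $p\in\mathcal{X}^{\Omega_n}$, $h\in\mathbb{S}(\Omega_m,\Omega_n)$ imply $p\circ h\in\mathcal{X}^{\Omega_m}$. A map $f:\mathcal{X}\to\mathcal{Y}$ is sample-smooth (a morphism of $\mathbf{SSS}$) if $f\circ p\in\mathcal{Y}^{\Omega_n}$ for all $n$ and $p\in\mathcal{X}^{\Omega_n}$. Write $\mathcal{X}^\Omega:=\mathcal{X}^{\Omega_0}$. Products have underlying set the cartesian product and plots the tuples of plots: $(\prod_i\mathcal{X}_i)^{\Omega_n}=\prod_i\mathcal{X}_i^{\Omega_n}$. The induced $\sigma$-algebra is $\mathcal{B}_{\mathcal{X}}:=\{A\subseteq\mathcal{X}: X^{-1}(A)\in\mathcal{B}_\Omega\ \forall X\in\mathcal{X}^\Omega\}$. **Space of measures.** $\mathsf{P}(\mathcal{X}):=\{X_*P: X\in\mathcal{X}^\Omega, P\in\mathsf{P}_\Omega\}$, a set of probability measures on $(\mathcal{X},\mathcal{B}_{\mathcal{X}})$, with plots $\mathsf{P}(\mathcal{X})^{\Omega_n}:=\{\mathsf{L}Y: Y\in\mathcal{X}^{\Omega_n}\}$, where $\mathsf{L}Y(t,\omega):=(\omega'\mapsto Y(t,\Theta^{-1}(\omega,\omega')))_*U$. **Structure maps.** $\mathsf{P}(f)(\mu):=f_*\mu$; $\delta_{\mathcal{X}}(x):=\delta_x$ (Dirac measure); $\mathbb{M}_{\mathcal{X}}(\Gamma):=\int\nu\,\Gamma(d\nu)$,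 i.e. $\mathbb{M}_{\mathcal{X}}(\Gamma)(A)=\int\nu(A)\,\Gamma(d\nu)$ for $A\in\mathcal{B}_{\mathcal{X}}$. For $\mu\in\mathsf{P}(\mathcal{X})$, $\nu\in\mathsf{P}(\mathcal{Y})$ the product measure $\mu\otimes\nu\in\mathsf{P}(\mathcal{X}\times\mathcal{Y})$ is defined on all of $\mathcal{B}_{\mathcal{X}\times\mathcal{Y}}$ by $(\mu\otimes\nu)(C)=\int\!\int \mathbf{1}[(X(\omega_1),Y(\omega_2))\in C]\,U(d\omega_2)\,U(d\omega_1)$ for any $X\in\mathcal{X}^\Omega$, $Y\in\mathcal{Y}^\Omega$ with $X_*U=\mu$, $Y_*U=\nu$ (such $X,Y$ exist and the value does not depend on them). *)

(* Defs.v *)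
From HB Require Import structures.
From mathcomp Require Import all_boot all_order all_algebra.
From mathcomp Require Import all_classical all_reals all_analysis.
From mathcomp Require Import measurable_realfun.

Set Implicit Arguments.
Unset Strict Implicit.
Unset Printing Implicit Defensive.
Import Order.TTheory GRing.Theory Num.Theory.
Import numFieldNormedType.Exports.

Local Open Scope classical_set_scope.
Local Open Scope ring_scope.

Declare Scope cat_scope.
Delimit Scope cat_scope with cat.

Record category := Category {
  Ob :> Type;
  Mor : Ob -> Ob -> Type;
  idmor : forall X, Mor X X;
  compmor : forall X Y Z, Mor Y Z -> Mor X Y -> Mor X Z;
  comp1m : forall X Y (f : Mor X Y), compmor (idmor Y) f = f;
  compm1 : forall X Y (f : Mor X Y), compmor f (idmor X) = f;
  compmA : forall X Y Z W (h : Mor Z W) (g : Mor Y Z) (f : Mor X Y),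
    compmor h (compmor g f) = compmor (compmor h g) f }.

Arguments Mor {c} _ _.
Arguments idmor {c} _.
Arguments compmor {c X Y Z} _ _.

Notation "g ∘ f" := (compmor g f) (at level 40, left associativity) : cat_scope.
Local Open Scope cat_scope.

Definition isomorphic (C : category) (X Y : C) :=
  exists (f : Mor X Y) (g : Mor Y X), g ∘ f = idmor X /\ f ∘ g = idmor Y.

Record cartesian (C : category) := Cartesian {
  terminal : C;
  bang : forall X, Mor X terminal;
  bang_uniq : forall X (f : Mor X terminal), f = bang X;
  times : C -> C -> C;
  pfst : forall X Y, Mor (times X Y) X;
  psnd : forall X Y, Mor (times X Y) Y;
  pairm : forall X Y Z, Mor Z X -> Mor Z Y -> Mor Z (times X Y);
  pfst_pairm : forall X Y Z (f : Mor Z X) (g : Mor Z Y),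
    pfst X Y ∘ pairm f g = f;
  psnd_pairm : forall X Y Z (f : Mor Z X) (g : Mor Z Y),
    psnd X Y ∘ pairm f g = g;
  pairm_uniq : forall X Y Z (h : Mor Z (times X Y)),
    h = pairm (pfst X Y ∘ h) (psnd X Y ∘ h) }.

Arguments times {C} _ _ _.
Arguments pfst {C} _ _ _.
Arguments psnd {C} _ _ _.
Arguments pairm {C} _ {X Y Z} _ _.

Section cartesian_monoidal.
Context {C : category} (K : cartesian C).
Local Notation "X × Y" := (times K X Y) (at level 38, left associativity).

Definition timesm (X X' Y Y' : C) (f : Mor X X') (g : Mor Y Y') :
  Mor (X × Y) (X' × Y') := pairm K (f ∘ pfst K X Y) (g ∘ psnd K X Y).

Definition associator (X Y Z : C) : Mor ((X × Y) × Z) (X × (Y × Z)) :=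
  pairm K (pfst K X Y ∘ pfst K (X × Y) Z)
    (pairm K (psnd K X Y ∘ pfst K (X × Y) Z) (psnd K (X × Y) Z)).

Definition braiding (X Y : C) : Mor (X × Y) (Y × X) :=
  pairm K (psnd K X Y) (pfst K X Y).

End cartesian_monoidal.

Record monad (C : category) (T : C -> C) := Monad {
  monad_map : forall X Y, Mor X Y -> Mor (T X) (T Y);
  unitm : forall X, Mor X (T X);
  joinm : forall X, Mor (T (T X)) (T X);
  monad_map_id : forall X, monad_map (idmor X) = idmor (T X);
  monad_map_comp : forall X Y Z (g : Mor Y Z) (f : Mor X Y),
    monad_map (g ∘ f) = monad_map g ∘ monad_map f;
  unitm_natural : forall X Y (f : Mor X Y), unitm Y ∘ f = monad_map f ∘ unitm X;
  joinm_natural : forall X Y (f : Mor X Y),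
    joinm Y ∘ monad_map (monad_map f) = monad_map f ∘ joinm X;
  joinm_unitm : forall X, joinm X ∘ unitm (T X) = idmor (T X);
  joinm_map_unitm : forall X, joinm X ∘ monad_map (unitm X) = idmor (T X);
  joinm_joinm : forall X, joinm X ∘ joinm (T X) = joinm X ∘ monad_map (joinm X) }.

Arguments monad_map {C T} _ {X Y} _.
Arguments unitm {C T} _ _.
Arguments joinm {C T} _ _.

Section strength.
Context {C : category} (K : cartesian C) (T : C -> C) (m : monad T).
Local Notation "X × Y" := (times K X Y) (at level 38, left associativity).
Local Notation I := (terminal K).

Record strength := Strength {
  st : forall X Y, Mor (X × T Y) (T (X × Y));
  st_natural : forall X X' Y Y' (f : Mor X X') (g : Mor Y Y'),
    monad_map m (timesm K f g) ∘ st X Y = st X' Y' ∘ timesm K f (monad_map m g);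
  st_unitor : forall X, monad_map m (psnd K I X) ∘ st I X = psnd K I (T X);
  st_associator : forall X Y Z,
    monad_map m (associator K X Y Z) ∘ st (X × Y) Z =
    st X (Y × Z) ∘ timesm K (idmor X) (st Y Z) ∘ associator K X Y (T Z);
  st_unitm : forall X Y,
    st X Y ∘ timesm K (idmor X) (unitm m Y) = unitm m (X × Y);
  st_joinm : forall X Y,
    st X Y ∘ timesm K (idmor X) (joinm m Y) =
    joinm m (X × Y) ∘ monad_map m (st X Y) ∘ st X (T Y) }.

Definition costrength (s : strength) (X Y : C) : Mor (T X × Y) (T (X × Y)) :=
  monad_map m (braiding K Y X) ∘ st s Y X ∘ braiding K (T X) Y.

Definition commutative_strength (s : strength) := forall X Y : C,
  joinm m (X × Y) ∘ monad_map m (costrength s X Y) ∘ st s (T X) Y =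
  joinm m (X × Y) ∘ monad_map m (st s X Y) ∘ costrength s X (T Y).

Definition affine := isomorphic (T I) I.

End strength.

Arguments st {C K T m} _ _ _.

Section cube.
Variable R : realType.

Definition cube := nat -> {i01 R}.

HB.instance Definition _ := gen_eqMixin cube.
HB.instance Definition _ := gen_choiceMixin cube.
HB.instance Definition _ := isPointed.Build cube (fun=> 0%:i01).

Definition cylinders : set_system cube :=
  [set A | exists (n : nat) (B : set R),
    measurable B /\ A = [set w | B (w n)%:num]].

Definition borel_cube : measurableType cylinders.-sigma :=
  g_sigma_algebraType cylinders.

Definition universally_measurable : set_system cube :=
  [set A | forall P : probability borel_cube R, completed_algebra_gen P A].

Lemma universally_measurable0 : universally_measurable set0.
Proof.
move=> P; exists set0 => //; exists set0; last by rewrite setU0.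
exact: negligible_set0.
Qed.

Lemma universally_measurableC A :
  universally_measurable A -> universally_measurable (~` A).
Proof.
move=> mA P; have [B mB [N [M [mM PM NM]] <-]] := mA P.
exists (~` (B `|` M)); first exact/measurableC/measurableU.
exists (M `&` ~` (B `|` N)).
  by exists M; split=> //; exact: subIsetl.
apply/seteqP; split=> [w [|[]//]|w BNw].
  by apply: subsetC; exact: setUS.
have [Mw|nMw] := pselect (M w); first by right.
by left=> -[Bw|//]; apply: BNw; left.
Qed.

Lemma universally_measurable_bigcup (F : (set cube)^nat) :
  (forall n, universally_measurable (F n)) ->
  universally_measurable (\bigcup_n F n).
Proof.
move=> mF P; have /choice[B FB] n : exists B : set borel_cube,
    measurable B /\ exists2 N, P.-negligible N & B `|` N = F n.
  by have [B mB [N PN <-]] := mF n P; exists B; split=> //; exists N.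
have /choice[N FN] n : exists N, P.-negligible N /\ B n `|` N = F n.
  by have [_ [N PN <-]] := FB n; exists N.
exists (\bigcup_n B n).
  by apply: bigcupT_measurable => n; exact: (FB n).1.
exists (\bigcup_n N n).
  by apply: negligible_bigcup => n; exact: (FN n).1.
by rewrite -bigcupU; apply: eq_bigcupr => n _; exact: (FN n).2.
Qed.

(* An alias of [cube], whose sigma-algebra is not that of [borel_cube]. *)
Definition Omega : Type := cube.

HB.instance Definition _ := Pointed.on Omega.
HB.instance Definition _ := @isMeasurable.Build default_measure_display Omega
  universally_measurable universally_measurable0 universally_measurableC
  universally_measurable_bigcup.

Definition is_uniform (P : probability Omega R) :=
  forall (n : nat) (B : nat -> set R), (forall i, measurable (B i)) ->
  P [set w | forall i, (i < n)%N -> B i (w i)%:num] =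
  (\prod_(i < n) uniform_prob (@ltr01 R) (B i))%E.

(* The product of countably many uniform laws. Such a P exists (Kolmogorov) and
   is unique on the measurable sets: there, [get] is a definite description. *)
Definition Unif : probability Omega R := get is_uniform.

Definition Theta (w : Omega) : Omega * Omega :=
  (fun n => w n.*2, fun n => w n.*2.+1).

Definition Theta_inv (w : Omega * Omega) : Omega :=
  fun n => if odd n then w.2 n./2 else w.1 n./2.

Lemma ThetaK : cancel Theta Theta_inv.
Proof.
move=> w; apply/funext => n; rewrite /Theta_inv /=.
by case: ifPn => [on|/negbTE on]; rewrite -[in RHS](odd_double_half n) on.
Qed.

Lemma Theta_invK : cancel Theta_inv Theta.
Proof.
move=> [w w']; rewrite /Theta /Theta_inv /=; congr (_, _); apply/funext => n.
  by rewrite odd_double doubleK.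
by rewrite /= odd_double /= uphalf_double.
Qed.

Definition site (n : nat) : Type := ('rV[R]_n * Omega)%type.

Definition partial m n (s : seq 'I_m) (f : 'rV[R]_m -> 'rV[R]_n) :
  'rV[R]_m -> 'rV[R]_n :=
  foldr (fun i g x => 'D_(delta_mx 0 i) g x) f s.

Definition smooth m n (f : 'rV[R]_m -> 'rV[R]_n) := forall s : seq 'I_m,
  continuous (partial s f) /\
  forall (i : 'I_m) x, derivable (partial s f) x (delta_mx 0 i).

Definition mixed_smooth m n (g : site m -> 'rV[R]_n) :=
  (forall w, smooth (fun t => g (t, w))) /\
  (forall t, measurable_fun [set: Omega]
    (fun w => g (t, w) : g_sigma_algebraType (@open 'rV[R]_n))).

Definition site_hom m n : set (site m -> site n) :=
  [set h | exists (g : site m -> 'rV[R]_n) (Phi : Omega -> Omega),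
    [/\ mixed_smooth g, measurable_fun [set: Omega] Phi &
        h = fun z => (g z, Phi z.2)]].

Record plotted := Plotted {
  carrier :> Type;
  plot : forall n, set (site n -> carrier) }.

Definition sample_smooth (X : plotted) :=
  (forall n (x : X), @plot X n (cst x)) /\
  (forall m n (p : site n -> X) (h : site m -> site n),
    plot p -> site_hom h -> plot (p \o h)).

Record sss := Sss { sss_plotted :> plotted; sssP : sample_smooth sss_plotted }.

Definition is_sss_map (X Y : plotted) (f : X -> Y) :=
  forall n (p : site n -> X), plot p -> plot (f \o p).

Record sss_map (X Y : plotted) := SssMap {
  sss_fun :> X -> Y;
  sss_funP : is_sss_map sss_fun }.

Lemma sss_map_ext (X Y : plotted) (f g : sss_map X Y) : f =1 g -> f = g.
Proof.
case: f g => [f fP] [g gP] /= /funext fg; subst g.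
by congr SssMap; exact: Prop_irrelevance.
Qed.

Definition sss_id (X : plotted) : sss_map X X :=
  @SssMap X X id (fun n p pp => pp).

Definition sss_comp (X Y Z : plotted) (g : sss_map Y Z) (f : sss_map X Y) :
  sss_map X Z :=
  @SssMap X Z (g \o f) (fun n p pp => sss_funP g (sss_funP f pp)).

Definition SSS : category.
Proof.
refine (@Category sss (fun X Y => sss_map X Y) (fun X => sss_id X)
  (fun X Y Z => @sss_comp X Y Z) _ _ _);
  by move=> *; exact: sss_map_ext.
Defined.

Definition sss_one_plotted : plotted := @Plotted unit (fun=> setT).

Lemma sss_one_subproof : sample_smooth sss_one_plotted. Proof. by []. Qed.

Definition sss_one : sss := Sss sss_one_subproof.

Definition sss_prod_plotted (X Y : plotted) : plotted :=
  @Plotted (X * Y) (fun n => [set p | plot (fst \o p) /\ plot (snd \o p)]).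

Lemma sss_prod_subproof (X Y : sss) : sample_smooth (sss_prod_plotted X Y).
Proof.
split=> [n [x y]|m n p h [p1 p2] hh].
  by split; [exact: (sssP X).1|exact: (sssP Y).1].
by split; [exact: (sssP X).2 p1 hh|exact: (sssP Y).2 p2 hh].
Qed.

Definition sss_prod (X Y : sss) : sss := Sss (sss_prod_subproof X Y).

Definition SSS_cartesian : cartesian SSS.
Proof.
refine (@Cartesian SSS sss_one
  (fun X => @SssMap X sss_one (fun=> tt) (fun n p _ => Logic.I)) _
  sss_prod
  (fun X Y => @SssMap (sss_prod X Y) X fst (fun n p pp => pp.1))
  (fun X Y => @SssMap (sss_prod X Y) Y snd (fun n p pp => pp.2))
  (fun X Y Z (f : sss_map Z X) (g : sss_map Z Y) =>
    @SssMap Z (sss_prod X Y) (fun z => (f z, g z))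
      (fun n p pp => conj (sss_funP f pp) (sss_funP g pp)))
  _ _ _).
- by move=> X f; apply: sss_map_ext => x /=; case: (sss_fun f x).
- by move=> *; exact: sss_map_ext.
- by move=> *; exact: sss_map_ext.
- by move=> X Y Z h; apply: sss_map_ext => z /=; case: (sss_fun h z).
Defined.

(* 𝒳^Ω := 𝒳^{Ω_0}, where Ω_0 = 'rV_0 * Ω is identified with Ω. *)
Definition plot0 (X : plotted) : set (Omega -> X) :=
  [set xi | plot (fun z : site 0 => xi z.2)].

Definition induced_sigma (X : plotted) : set_system X :=
  [set A | forall xi, @plot0 X xi -> measurable (xi @^-1` A)].

Lemma induced_sigma0 (X : plotted) : induced_sigma (set0 : set X).
Proof. by move=> xi _; rewrite preimage_set0; exact: measurable0. Qed.

Lemma induced_sigmaC (X : plotted) (A : set X) :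
  induced_sigma A -> induced_sigma (~` A).
Proof. by move=> mA xi xiP; exact/measurableC/mA. Qed.

Lemma induced_sigma_bigcup (X : plotted) (F : (set X)^nat) :
  (forall n, induced_sigma (F n)) -> induced_sigma (\bigcup_n F n).
Proof.
move=> mF xi xiP; rewrite preimage_bigcup.
by apply: bigcupT_measurable => n; exact: mF.
Qed.

(* The library's measurable types are pointed, but a sample-smooth space may be
   empty: (𝒳, 𝓑_𝒳) is a measurableType only once a base point is chosen. *)
Definition induced_space (X : plotted) (x0 : X) : Type := X.

Section induced_space.
Variables (X : plotted) (x0 : X).
HB.instance Definition _ := gen_eqMixin (induced_space x0).
HB.instance Definition _ := gen_choiceMixin (induced_space x0).
HB.instance Definition _ := isPointed.Build (induced_space x0) x0.
HB.instance Definition _ := @isMeasurable.Build default_measure_display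
  (induced_space x0) (@induced_sigma X) (@induced_sigma0 X) (@induced_sigmaC X)
  (@induced_sigma_bigcup X).
End induced_space.

(* f_* mu as a measure on 𝓑_𝒳. Giving it the value 0 off 𝓑_𝒳 makes equality of
   functions [set X -> \bar R] coincide with equality of measures on 𝓑_𝒳. *)
Definition image_measure (T : Type) (X : plotted) (f : T -> X)
    (mu : set T -> \bar R) : set X -> \bar R :=
  fun A => if `[< induced_sigma A >] then mu (f @^-1` A) else 0%E.

Record measures (X : plotted) := Measures {
  measure_val :> set X -> \bar R;
  measure_valP : exists (xi : Omega -> X) (P : probability Omega R),
    plot0 xi /\ measure_val = image_measure xi P }.

Definition sample_law (X : plotted) n (Y : site n -> X) (z : site n) :
  set X -> \bar R :=
  image_measure (fun w' => Y (z.1, Theta_inv (z.2, w'))) Unif.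

Definition measures_plotted (X : plotted) : plotted :=
  @Plotted (measures X) (fun n => [set p | exists Y : site n -> X,
    plot Y /\ forall z, measure_val (p z) = sample_law Y z]).

Definition is_product_measure (X Y : plotted) (mu : measures X)
    (nu : measures Y) (rho : measures (sss_prod_plotted X Y)) :=
  let represents (xi : Omega -> X) (eta : Omega -> Y) :=
    [/\ plot0 xi, plot0 eta, measure_val mu = image_measure xi Unif &
        measure_val nu = image_measure eta Unif] in
  (exists xi eta, represents xi eta) /\
  forall xi eta, represents xi eta ->
  forall C, induced_sigma C ->
  rho C = (\int[Unif]_w1 \int[Unif]_w2 (\1_C (xi w1, eta w2))%:E)%E.

End cube.

Arguments measures_plotted {R} X.
Arguments induced_sigma {R} X _.

(* Main.v *)
Require Import Defs.
From HB Require Import structures.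
From mathcomp Require Import all_boot all_order all_algebra.
From mathcomp Require Import all_classical all_reals all_analysis.
From mathcomp Require Import measurable_realfun lra zify.

Set Implicit Arguments.
Unset Strict Implicit.
Unset Printing Implicit Defensive.
Import Order.TTheory GRing.Theory Num.Theory.
Import numFieldNormedType.Exports.

Local Open Scope classical_set_scope.
Local Open Scope ring_scope.

(** The theorem is a statement about splitting randomness. A sample [w] of
    [Omega] carries two independent uniform samples [theta1 w] and [theta2 w],
    and a plot of P(X) is a plot of X in which the second half has been
    forgotten. Hence every structure map acts on plots by a rearrangement of
    the sample: [dirac_map] ignores the fresh half, [join_map] merges two
    fresh halves into one ([reassociate]), and the strength leaves the fresh
    half alone. This is why they are morphisms.

    On points, every element of P(X) is the law, under the uniform measure U,
    of some random element of X ([measures_law]), and the mixture of the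
    random measure represented by [xi] has the value [\int[U]_w xi w A] at [A]
    ([mixtureE]). The laws thereby become identities between integrals against
    U. The unit laws and the naturality squares are immediate; associativity
    is invariance of U under rebracketing of three samples
    ([Unif_reassociate]); commutativity, and the formula for the strength as a
    product measure, are exchanges of two integrals ([fubini_pair]).

    A set of B_X is only ever seen through its preimages under random
    elements, which are universally measurable subsets of [Omega]. So all the
    measure theory takes place on [Omega], and X may be any sample-smooth
    space: the slices of a universally measurable set have measures that
    depend on the base point in a universally measurable way
    ([measurable_fun_slice]) and integrate to the measure of the set
    ([fubini_Unif]). Both follow from the Borel case by squeezing the set
    between two Borel sets whose difference is null.

    Two facts about [Omega] are needed besides. Every probability on it is the
    law of a measurable self-map under U ([randomization]): the Borel cube
    embeds into the line with a Borel left inverse ([ternaryK],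
    [rational_bitsK]), and on the line one takes quantiles ([law_quantile]).
    And U exists ([is_uniform_exists]): quantiles also turn one uniform number
    into two independent ones ([unif01_split]), and repeating this on the
    second number yields an independent uniform sequence. *)

(** * Universal measurability and completion *)

Section pushforward_probability.
Context d d' (T : measurableType d) (T' : measurableType d') (R : realType).
Variables (P : probability T R) (f : T -> T') (mf : measurable_fun [set: T] f).

Let mfM := isMeasurableFun.Build _ _ _ _ _ mf.
Let fM : {mfun T >-> T'} := HB.pack f mfM.

Definition push : probability T' R := distribution P fM.

Lemma pushE A : push A = P (f @^-1` A). Proof. by []. Qed.

End pushforward_probability.

Lemma measurable_preimage d d' (T : measurableType d) (T' : measurableType d')
    (f : T -> T') A :
  measurable_fun [set: T] f -> measurable A -> measurable (f @^-1` A).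
Proof. by move=> mf mA; rewrite -[X in measurable X]setTI; exact: mf. Qed.

Lemma null_setD_eq d (T : measurableType d) (R : realType)
    (P : {measure set T -> \bar R}) (B C : set T) :
  measurable B -> measurable C -> B `<=` C -> P (C `\` B) = 0%E -> P C = P B.
Proof.
move=> mB mC BC PCB; rewrite -[X in P X = _](setDUK BC) measureU//=.
- by rewrite PCB adde0.
- exact: measurableD.
- by rewrite setDIK.
Qed.

Section universal.
Variable R : realType.
Local Notation cube := (cube R).
Local Notation borel := (borel_cube R).
Local Notation Omega := (Omega R).

(** With Borel bounds on both sides, a universally measurable set can be
    squeezed in any construction that is monotone in the set. *)
Lemma universally_measurableP (A : set cube) : universally_measurable A <->
  forall P : probability borel R, exists B C : set borel,
    [/\ measurable B, measurable C, B `<=` A, A `<=` C & P (C `\` B) = 0%E].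
Proof.
split=> [mA P|mA P].
  have [B mB [N [M [mM PM NM]] <-]] := mA P.
  exists B, (B `|` M); split=> //; [exact: measurableU|exact: setUS|].
  apply/eqP; rewrite -measure_le0 -PM le_measure ?inE//.
    by apply: measurableD => //; exact: measurableU.
  by move=> w [[]].
have [B [C [mB mC BA AC PBC]]] := mA P.
exists B => //; exists (A `\` B); last by rewrite setDUK.
by exists (C `\` B); split=> //; [exact: measurableD|exact: setSD].
Qed.

Lemma borel_Omega_measurable (A : set cube) :
  measurable (A : set borel) -> measurable (A : set Omega).
Proof.
move=> mA; apply/universally_measurableP => P.
by exists A, A; split=> //; rewrite setDv measure0.
Qed.

Lemma measurable_Omega_borel :
  measurable_fun [set: Omega] (id : Omega -> borel).
Proof. by move=> _ A mA; rewrite setTI; exact: borel_Omega_measurable. Qed.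

Definition borel_restr (P : probability Omega R) : probability borel R :=
  push P measurable_Omega_borel.

Section completion.
Local Open Scope ereal_scope.
Variable P : probability borel R.

(** The inner measure of P. On a universally measurable set it is the measure
    of any Borel set that fits inside up to a null set; taking a supremum
    avoids choosing one such set for each [A]. *)
Definition inner_value (A : set Omega) : \bar R :=
  ereal_sup [set P B | B in [set B : set borel | measurable B /\ B `<=` A]].

Lemma inner_valueE (A : set Omega) (B C : set borel) : measurable B ->
  measurable C -> B `<=` A -> A `<=` C -> P (C `\` B) = 0 ->
  inner_value A = P B.
Proof.
move=> mB mC BA AC PCB; apply/eqP; rewrite eq_le; apply/andP; split; last first.
  by apply: ereal_sup_ubound; exists B.
apply: ge_ereal_sup => _ [D [mD DA] <-].
rewrite -(null_setD_eq mB mC (subset_trans BA AC) PCB).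
by rewrite le_measure ?inE//; exact: subset_trans AC.
Qed.

Lemma inner_value_borel (A : set borel) : measurable A -> inner_value A = P A.
Proof. by move=> mA; rewrite (inner_valueE mA mA)// setDv measure0. Qed.

Let inner_value0 : inner_value set0 = 0.
Proof. exact: etrans (inner_value_borel measurable0) (measure0 P). Qed.

Let inner_value_ge0 A : 0 <= inner_value A.
Proof. by apply: ereal_sup_ubound; exists set0; [split|exact: measure0]. Qed.

Let inner_value_sigma_additive : semi_sigma_additive inner_value.
Proof.
move=> F mF tF _.
have /choice[B HB] n : exists B : set borel, exists C : set borel,
    [/\ measurable B, measurable C, B `<=` F n, F n `<=` C & P (C `\` B) = 0].
  exact: (universally_measurableP _).1 (mF n) P.
have [C HC] := choice HB.
have mB n : measurable (B n) by case: (HC n).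
have mC n : measurable (C n) by case: (HC n).
have mUB : measurable (\bigcup_n B n) by exact: bigcupT_measurable.
have mUC : measurable (\bigcup_n C n) by exact: bigcupT_measurable.
rewrite (inner_valueE mUB mUC); last 3 first.
- by move=> w [n _ Bn]; exists n => //; case: (HC n) => _ _ + _ _; exact.
- by move=> w [n _ Bn]; exists n => //; case: (HC n) => _ _ _ + _; exact.
(* The union of the inner bounds fits inside the union, because the differences
   of the outer and the inner unions are covered by countably many null sets. *)
- have : P (\bigcup_n (C n `\` B n)) <= 0.
    have mCB n : measurable (C n `\` B n) by exact: measurableD.
    have /le_trans-> // := generalized_Boole_inequality P mCB
      (bigcupT_measurable _ mCB).
    by rewrite eseries0// => n _ _; case: (HC n).
  move=> PCB; apply/eqP; rewrite -measure_le0; apply: le_trans PCB.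
  rewrite le_measure ?inE//; first exact: measurableD.
    by apply: bigcupT_measurable => n; exact: measurableD.
  move=> w [[n _ Cn] nB]; exists n => //; split=> // Bn.
  by apply: nB; exists n.
have -> : (fun n => \sum_(0 <= i < n) inner_value (F i)) =
          (fun n => \sum_(0 <= i < n) P (B i)).
  apply/funext => n; apply: eq_bigr => i _.
  by case: (HC i) => mBi mCi BF FC PCB; exact: inner_valueE mBi mCi BF FC PCB.
apply: measure_semi_sigma_additive => //; apply/trivIsetP => i j _ _ ij.
move/trivIsetP : tF => /(_ i j I I ij) Fij.
by apply: subsetI_eq0 Fij; [case: (HC i)|case: (HC j)].
Qed.

HB.instance Definition _ := isMeasure.Build _ _ _ inner_value
  inner_value0 inner_value_ge0 inner_value_sigma_additive.

Let inner_valueT : inner_value setT = 1.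
Proof. by rewrite (inner_value_borel measurableT) probability_setT. Qed.

HB.instance Definition _ :=
  Measure_isProbability.Build _ _ _ inner_value inner_valueT.

Definition completion : probability Omega R := inner_value.

Lemma completionE (A : set borel) : measurable A -> completion A = P A.
Proof. exact: inner_value_borel. Qed.

End completion.

(** P and Q have the same Borel null sets, so a set squeezed for one of them
    is squeezed for the other by the same bounds. *)
Lemma eq_probability_Omega (P Q : probability Omega R) :
  (forall A : set borel, measurable A -> P A = Q A) ->
  forall A : set Omega, measurable A -> P A = Q A.
Proof.
move=> PQ A mA.
have [B [C [mB mC BA AC PCB]]] :=
  (universally_measurableP A).1 mA (borel_restr P).
suff key (S : probability Omega R) : S (C `\` B) = 0%E -> S A = S B.
  rewrite (key P)// (key Q)//; first exact: PQ.
  by rewrite -PQ//; exact: measurableD.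
have mB' : measurable (B : set Omega) by exact: borel_Omega_measurable.
move=> SCB; apply: null_setD_eq => //; apply/eqP.
rewrite -measure_le0 -SCB le_measure ?inE//;
  [exact: measurableD| |exact: setSD].
by apply: measurableD => //; exact: borel_Omega_measurable.
Qed.

Lemma negligible_completion P (A : set Omega) :
  measurable A -> completion P A = 0%E -> P.-negligible A.
Proof.
move=> mA PA.
have [B [C [mB mC BA AC PCB]]] := (universally_measurableP A).1 mA P.
exists C; split=> //; apply: etrans PA.
apply: etrans (null_setD_eq mB mC (subset_trans BA AC) PCB) _.
exact/esym/(inner_valueE mB mC BA AC PCB).
Qed.

(** Completing twice adds nothing: the bounds may be universally measurable
    instead of Borel. *)
Lemma universally_measurable_sandwich (A : set Omega) :
  (forall P : probability borel R, exists B C : set Omega,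
    [/\ measurable B, measurable C, B `<=` A, A `<=` C &
        completion P (C `\` B) = 0%E]) -> measurable A.
Proof.
move=> H; suff : universally_measurable A by [].
move=> P; have [B [C [mB mC BA AC PCB]]] := H P.
have [B1 mB1 [N nN BE]] := (mB : universally_measurable B) P.
exists B1 => //; exists (N `|` (A `\` B)); last by rewrite setUA BE setDUK.
have nCB : P.-negligible (C `\` B).
  by apply: negligible_completion => //; exact: measurableD.
by apply: negligibleU => //; apply: negligibleS nCB; exact: setSD.
Qed.

(** Bounds for [A] with respect to the image law pull back to bounds for the
    preimage of [A]. Self-maps of [Omega] can thus be checked against Borel
    sets, hence one coordinate at a time. *)
Lemma measurable_to_Omega (f : Omega -> Omega) :
  measurable_fun [set: Omega] (f : Omega -> borel) ->
  measurable_fun [set: Omega] f.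
Proof.
move=> mf _ A mA; rewrite setTI; apply: universally_measurable_sandwich => P.
have [B [C [mB mC BA AC PCB]]] :=
  (universally_measurableP A).1 mA (push (completion P) mf).
exists (f @^-1` B), (f @^-1` C).
split=> //.
- exact: measurable_preimage mf mB.
- exact: measurable_preimage mf mC.
- exact: preimage_subset.
- exact: preimage_subset.
Qed.

End universal.

(** * The quantile transform *)

Definition unif01 (R : realType) : probability (measurableTypeR R) R :=
  uniform_prob (@ltr01 R).

Lemma unif01_subset (R : realType) (A : set R) : measurable A ->
  A `<=` `]0, 1[ -> unif01 R A = lebesgue_measure A.
Proof.
move=> mA A01; rewrite /unif01/= /uniform_prob.
rewrite (eq_integral (cst 1%E)) => [|x /set_mem /A01/=].
  by rewrite integral_cst// mul1e.
rewrite in_itv/= => /andP[x0 x1].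
by rewrite /uniform_pdf !ltW//= subr0 invr1.
Qed.

(** The endpoints of the unit interval carry no mass; on the open interval all
    quantiles are finite. *)
Lemma unif01E (R : realType) (A : set R) : measurable A ->
  unif01 R A = lebesgue_measure (A `&` `]0, 1[).
Proof.
move=> mA; have l1 : unif01 R `]0, 1[%classic = 1%E.
  by rewrite unif01_subset// lebesgue_measure_itv/= lte_fin ltr01 sube0.
rewrite -unif01_subset; [|exact: measurableI|exact: subIsetr].
rewrite -[in LHS](setIT A) -(setUv `]0, 1[) setIUr measureU//=.
- rewrite [X in (_ + X)%E](_ : _ = 0%E) ?adde0//.
  apply/eqP; rewrite -measure_le0 (_ : 0%E = unif01 R (~` `]0, 1[%classic))//.
    by rewrite le_measure ?inE//; [apply: measurableI|]; try exact: measurableC.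
  by rewrite probability_setC//= l1 subee.
- exact: measurableI.
- by apply: measurableI => //; exact: measurableC.
- by rewrite setIACA setICr setI0.
Qed.

Section quantile.
Context d (T : measurableType d) (R : realType) (P : probability T R).
Variable X : {RV P >-> R}.
Local Notation F := (cdf X).

(** Outside of ]0, 1[ the set may be empty or unbounded below; the value 0
    there affects a null set. *)
Definition quantile (u : R) : R :=
  if 0 < u < 1 then inf [set x | (u%:E <= F x)%E] else 0.

(** The Galois connection between quantiles and the distribution function. The
    nontrivial implication is right continuity: the infimum belongs to the
    set. *)
Lemma quantile_le u x : 0 < u < 1 -> (quantile u <= x) = (u%:E <= F x)%E.
Proof.
move=> u01; rewrite /quantile u01; case/andP: u01 => u0 u1.
set S := [set x | _].
have [y Sy] : S !=set0.
  apply/not_existsP => S0; suff : (1 <= u%:E)%E by rewrite lee_fin leNgt u1.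
  apply: (cvge_to_le (cvg_cdfy1 X)); apply: nearW => z.
  by have /negP := S0 z; rewrite -ltNge => /ltW.
have [x0 Fx0] : exists x0, (F x0 < u%:E)%E.
  apply/not_existsP => S0; suff : (u%:E <= 0)%E by rewrite lee_fin leNgt u0.
  apply: (cvge_to_ge (cvg_cdfNy0 X)); apply: nearW => z.
  by have /negP := S0 z; rewrite -leNgt.
have lS : has_lbound S.
  exists x0 => z Sz; rewrite leNgt; apply/negP => zx0.
  have := le_lt_trans (le_trans Sz (cdf_nondecreasing X (ltW zx0))) Fx0.
  by rewrite ltxx.
apply/idP/idP => [qx|Sx]; last exact: ge_inf.
have FS r : inf S < r -> (u%:E <= F r)%E.
  move=> /inf_lt[]; first by exists y.
  move=> z Sz zr; apply: le_trans Sz _; exact/cdf_nondecreasing/ltW.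
apply: le_trans (cdf_nondecreasing X qx).
apply: (cvge_to_ge (@cdf_right_continuous _ _ _ _ X (inf S))).
by near=> r; apply: FS; near: r; exact: nbhs_right_gt.
Unshelve. all: by end_near. Qed.

Lemma quantile_preimage x : quantile @^-1` `]-oo, x] `&` `]0, 1[ =
  [set u | (u%:E <= F x)%E] `&` `]0, 1[.
Proof.
apply/seteqP; split=> u /=; rewrite !in_itv/= => -[qu u01]; split=> //.
  by rewrite -quantile_le.
by rewrite quantile_le.
Qed.

Lemma measurable_quantile : measurable_fun [set: R] quantile.
Proof.
have mI : measurable (`]0, 1[%classic : set R) by exact: measurable_itv.
rewrite -(setvU `]0, 1[%classic).
apply: (measurable_funU quantile (measurableC mI) mI).2; split.
  apply: (eq_measurable_fun (fun=> 0 : R)) => [u|].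
    by rewrite inE /quantile/= in_itv/= => /negP/negbTE ->.
  exact: measurable_cst.
apply: (measurability _ (RGenOInfty.measurableE R)).
move=> _ [_ [x ->] <-].
have FE : F x = (fine (F x))%:E by rewrite fineK// fin_num_measure.
rewrite (_ : _ `&` _ = `]fine (F x), +oo[ `&` `]0, 1[).
  exact: measurableI.
apply/seteqP; split=> u /=; rewrite !in_itv/= !andbT => -[].
  by move=> u01; rewrite ltNge quantile_le// FE lee_fin -ltNge.
by move=> Fu u01; split=> //; rewrite ltNge quantile_le// FE lee_fin -ltNge.
Qed.

(** By [quantile_le], [quantile u <= x] means [u <= F x], an event of length
    [F x]; and half-lines determine a law. *)
Lemma law_quantile (A : set R) : measurable A ->
  unif01 R (quantile @^-1` A) = P (X @^-1` A).
Proof.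
pose Q := push (@unif01 R) measurable_quantile.
suff QX x : Q `]-oo, x]%classic = distribution P X `]-oo, x]%classic.
  move=> mA.
  apply: (@measure_unique _ _ _ (@RGenOInfty.G R)
    (fun n => `]- n%:R, +oo[%classic) _ _ _ _ Q (distribution P X)) => //.
  - exact: RGenOInfty.measurableE.
  - move=> _ _ [x ->] [y ->]; exists (Num.max x y).
    apply/seteqP; split=> z /=; rewrite !in_itv/= !andbT gt_max => /andP//.
  - by move=> n; exists (- n%:R).
  - apply/seteqP; split=> // x _; exists (Num.trunc `|x|).+1 => //=.
    rewrite in_itv/= andbT ltrNl (le_lt_trans (ler_norm _))// normrN.
    exact: truncnS_gt.
  - move=> B [x ->]; rewrite -setCitvl.
    by rewrite [LHS]probability_setC// [RHS]probability_setC// QX.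
  - by move=> n; rewrite (le_lt_trans (probability_le1 _ _)) ?ltry.
rewrite pushE unif01E; last first.
  exact: measurable_preimage measurable_quantile _.
rewrite quantile_preimage.
have FE : F x = (fine (F x))%:E by rewrite fineK// fin_num_measure.
transitivity (F x) => //.
have F0 : 0 <= fine (F x) by exact: fine_ge0.
have : (F x <= 1)%E by exact: cdf_le1.
rewrite FE lee_fin le_eqVlt => /orP[/eqP|] F1.
  rewrite F1 (_ : _ `&` _ = `]0, 1[%classic).
    by rewrite lebesgue_measure_itv/= lte_fin ltr01 sube0.
  apply/seteqP; split=> u /=; first by case.
  by rewrite in_itv/= lee_fin => u01; split=> //; case/andP: u01 => _ /ltW.
rewrite (_ : _ `&` _ = `]0, fine (F x)]%classic).
  rewrite lebesgue_measure_itv/= lte_fin.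
  by case: ltP => [_|F0']; [rewrite sube0|congr EFin; lra].
apply/seteqP; split=> u /=; rewrite !in_itv/= lee_fin.
  by case=> -> /andP[-> _].
by move=> /andP[u0 uF]; split=> //; rewrite u0 (le_lt_trans uF).
Qed.

End quantile.

(** * Encoding the Borel cube in the line *)

Section coding.
Variable R : realType.
Implicit Types (b : nat -> bool) (x : R).

(** The partial sums of the series of [2 b_k / 3 ^ (k + 1)], in Horner form.
    Base 3 with the digits 0 and 2 leaves the gap ]1/3, 2/3[, so that the
    digits can be recovered; in base 2 a dyadic number would have two
    expansions. *)
Fixpoint ternary_partial n b : R :=
  if n is n'.+1
  then ((if b 0 then 2 else 0) + ternary_partial n' (b \o succn)) / 3 else 0.

Lemma ternary_partial_itv n b : 0 <= ternary_partial n b <= 1.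
Proof.
elim: n b => [|n IH] b /=; first by rewrite lexx ler01.
have /andP[h0 h1] := IH (b \o succn).
by case: (b 0) => /=; lra.
Qed.

Lemma ternary_partial_nd b : nondecreasing_seq (ternary_partial ^~ b).
Proof.
apply/nondecreasing_seqP => n.
elim: n b => [|n IH] b.
  by rewrite [ternary_partial 0 b]/=; case/andP: (ternary_partial_itv 1 b).
rewrite [ternary_partial n.+2 b]/= [X in X <= _]/=.
by rewrite ler_pM2r ?invr_gt0// lerD2l; exact: IH.
Qed.

Definition ternary b : R := limn (ternary_partial ^~ b).

Lemma cvg_ternary b : ternary_partial ^~ b @ \oo --> ternary b.
Proof.
apply: nondecreasing_is_cvgn; first exact: ternary_partial_nd.
by exists 1 => _ [n _ <-]; case/andP: (ternary_partial_itv n b).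
Qed.

Lemma ternary_itv b : 0 <= ternary b <= 1.
Proof.
apply/andP; split.
  by apply: limr_ge; [exact: cvg_ternary|apply: nearW => n;
    case/andP: (ternary_partial_itv n b)].
by apply: limr_le; [exact: cvg_ternary|apply: nearW => n;
  case/andP: (ternary_partial_itv n b)].
Qed.

Lemma ternaryS b :
  ternary b = ((if b 0 then 2 else 0) + ternary (b \o succn)) / 3.
Proof.
apply/cvg_lim => //; rewrite -cvg_shiftS/=.
apply: cvgMl; apply: cvgD; first exact: cvg_cst.
exact: cvg_ternary.
Qed.

(** Any threshold inside the gap ]1/3, 2/3[ reads the first digit; subtracting
    it and rescaling shifts the expansion. *)
Fixpoint ternary_digit n x : bool :=
  if n is n'.+1
  then ternary_digit n' (3 * x - (if 1 / 2 < x then 2 else 0)) else 1 / 2 < x.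

Lemma ternaryK b n : ternary_digit n (ternary b) = b n.
Proof.
elim: n b => [|n IH] b.
  rewrite /= ternaryS; have /andP[h0 h1] := ternary_itv (b \o succn).
  by case: (b 0) => /=; [apply/idP|apply/negP]; lra.
have d0 : (1 / 2 < ternary b) = b 0.
  rewrite ternaryS; have /andP[h0 h1] := ternary_itv (b \o succn).
  by case: (b 0) => /=; [apply/idP|apply/negP]; lra.
rewrite /= d0 -[RHS](IH (b \o succn)); congr ternary_digit.
by rewrite ternaryS; case: (b 0) => /=; lra.
Qed.

Lemma measurable_ternary d (T : measurableType d) (b : T -> nat -> bool) :
  (forall n, measurable_fun [set: T] (b ^~ n)) ->
  measurable_fun [set: T] (ternary \o b).
Proof.
move=> mb.
apply: (@measurable_fun_cvg _ _ _ _ (fun n t => ternary_partial n (b t))).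
  move=> n; elim: n b mb => [|n IH] b mb /=; first exact: measurable_cst.
  apply: measurable_funM => //; apply: measurable_funD; last first.
    by apply: (IH (fun t => b t \o succn)) => k; exact: mb.
  exact: measurable_fun_ifT.
by move=> t _; exact: cvg_ternary.
Qed.

Lemma measurable_ternary_digit n : measurable_fun [set: R] (ternary_digit n).
Proof.
elim: n => [|n IH] /=; first exact: measurable_fun_ltr.
apply: (measurableT_comp IH); apply: measurable_funB.
  exact: measurable_funM.
by apply: measurable_fun_ifT => //; exact: measurable_fun_ltr.
Qed.

End coding.

Section borel_cube.
Variable R : realType.
Local Notation borel := (borel_cube R).

Lemma measurable_coord n :
  measurable_fun [set: borel] (fun w : borel => (w n)%:num : R).
Proof.
by move=> _ B mB; rewrite setTI; apply: sub_sigma_algebra; exists n, B.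
Qed.

Lemma measurable_to_borel_cube d (T : measurableType d) (f : T -> borel) :
  (forall n, measurable_fun [set: T] (fun t => (f t n)%:num : R)) ->
  measurable_fun [set: T] f.
Proof.
move=> mf; apply: (measurability (@cylinders R : set (set borel)) erefl).
by move=> _ [_ [n [B [mB ->]]] <-]; exact: mf.
Qed.

(** Coordinates of the cube are subtype elements: [clamp] is the left inverse
    of their inclusion into the line, sent to 0 outside of the unit interval.
    *)
Definition clamp (x : R) : {i01 R} := xget 0%:i01 [set y | y%:num = x].

Lemma clampE x : (clamp x)%:num = if 0 <= x <= 1 then x else 0.
Proof.
rewrite /clamp; case: ifPn => [/andP[x0 x1]|x01].
  by apply: (@xgetPex _ _ [set y : {i01 R} | y%:num = x]); exists (Itv01 x0 x1).
rewrite xgetPN// => y /= yx; case/negP: x01; rewrite -yx.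
by rewrite ge0 le1.
Qed.

Lemma clampK (y : {i01 R}) : clamp y%:num = y.
Proof. by apply/val_inj; rewrite /= clampE ge0 le1. Qed.

Lemma measurable_clamp : measurable_fun [set: R] (fun x => (clamp x)%:num : R).
Proof.
rewrite (_ : (fun x => _) = (fun x => if 0 <= x <= 1 then x else 0));
  last by apply/funext => x; exact: clampE.
apply: measurable_fun_ifT => //.
by apply: measurable_and; exact: measurable_fun_ler.
Qed.

Lemma unif01_clamp (A : set R) : measurable A ->
  unif01 R [set x | A (clamp x)%:num] = unif01 R A.
Proof.
move=> mA; rewrite !unif01E//.
  2: exact: measurable_preimage measurable_clamp mA.
congr lebesgue_measure; apply/seteqP; split=> x /=; rewrite in_itv/= clampE;
  by case=> + /andP[x0 x1]; rewrite !ltW// x0 x1.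
Qed.

(** The bit numbered by the pair [(k, q)] compares the [k]-th coordinate with
    the rational [q]: countably many Borel tests that separate the points. *)
Definition rational_bits (w : borel) (m : nat) : bool :=
  if unpickle m is Some (k, q) then (ratr q : R) < (w k)%:num else false.

(** The supremum over [m] of these numbers is the [k]-th coordinate of the
    point coded by [b]: they are the rationals that [b] places below it.
    Clamping keeps the family bounded for arbitrary [b]. *)
Definition threshold (b : nat -> bool) (k m : nat) : R :=
  if unpickle m is Some (k', q) then
    if (k' == k) && b m then (clamp (ratr (q : rat)))%:num else 0
  else 0.

Definition of_rational_bits (b : nat -> bool) : borel :=
  fun k => clamp (sups (threshold b k) 0).

Lemma threshold_itv b k m : 0 <= threshold b k m <= 1.
Proof.
rewrite /threshold; case: unpickle => [[k' q]|]; last by rewrite lexx ler01.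
by case: ifP => _; [rewrite ge0 le1|rewrite lexx ler01].
Qed.

Lemma threshold_ub b k : has_ubound (range (threshold b k)).
Proof. by exists 1 => _ [m _ <-]; case/andP: (threshold_itv b k m). Qed.

Lemma rational_bitsK : cancel rational_bits of_rational_bits.
Proof.
move=> w; apply/funext => k.
rewrite /of_rational_bits -[RHS]clampK; congr clamp.
set s := sups _ _; have sE m : threshold (rational_bits w) k m <= s.
  apply: sup_ubound; last by exists m.
  by exists 1 => _ [i _ <-]; case/andP: (threshold_itv (rational_bits w) k i).
have s0 : 0 <= s.
  by apply: le_trans (sE 0); case/andP: (threshold_itv (rational_bits w) k 0).
apply/eqP; rewrite eq_le; apply/andP; split.
  apply: sup_le_ub; first by exists (threshold (rational_bits w) k 0), 0.
  move=> _ [m _ <-]; rewrite /threshold /rational_bits.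
  case: unpickle => [[k' q]|]; last exact: ge0.
  case: ifPn => [/andP[/eqP -> /ltW qw]|_]; last exact: ge0.
  by rewrite clampE; case: ifP.
rewrite leNgt; apply/negP => /rat_in_itvoo[q]; rewrite in_itv/= => /andP[sq qw].
have := sE (pickle (k, q)); rewrite /threshold /rational_bits pickleK eqxx qw/=.
rewrite clampE (le_trans s0 (ltW sq)) (le_trans (ltW qw))//=.
by rewrite leNgt sq.
Qed.

Lemma measurable_rational_bits m :
  measurable_fun [set: borel] (rational_bits ^~ m).
Proof.
rewrite /rational_bits; case: unpickle => [[k q]|]; last exact: measurable_cst.
by apply: measurable_fun_ltr => //; exact: measurable_coord.
Qed.

Lemma measurable_of_rational_bits d (T : measurableType d)
    (b : T -> nat -> bool) :
  (forall n, measurable_fun [set: T] (b ^~ n)) ->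
  measurable_fun [set: T] (of_rational_bits \o b).
Proof.
move=> mb; apply: measurable_to_borel_cube => k /=.
apply: (measurableT_comp measurable_clamp).
apply: (measurable_fun_sups (h := fun m t => threshold (b t) k m)).
  by move=> t _; exact: threshold_ub.
move=> m; rewrite /threshold; case: unpickle => [[k' q]|].
  by apply: measurable_fun_ifT => //; apply: measurable_and.
exact: measurable_cst.
Qed.

(** Encode the cube in the line, take the quantile function of the law of the
    code, and decode. *)
Theorem randomization_borel (Q : probability borel R) :
  exists2 f : R -> borel, measurable_fun [set: R] f &
    forall A, measurable A -> unif01 R (f @^-1` A) = Q A.
Proof.
have mX := @measurable_ternary R _ _ _ measurable_rational_bits.
pose X : {RV Q >-> R} := HB.pack (@ternary R \o rational_bits)
  (isMeasurableFun.Build _ _ _ _ _ mX).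
pose decode (x : R) : borel := of_rational_bits (fun n => @ternary_digit R n x).
have mdecode : measurable_fun [set: R] decode.
  by apply: measurable_of_rational_bits => n; exact: measurable_ternary_digit.
have decodeK w : decode (X w) = w.
  rewrite /decode -[RHS]rational_bitsK; congr of_rational_bits.
  by apply/funext => n; exact: ternaryK.
exists (decode \o quantile X).
  exact: measurableT_comp mdecode (measurable_quantile X).
move=> A mA; rewrite comp_preimage law_quantile; last first.
  exact: measurable_preimage mdecode mA.
congr (Q _); apply/seteqP; split=> w /=; by rewrite decodeK.
Qed.

End borel_cube.

(** * The uniform measure *)

Section uniform.
Variable R : realType.
Local Notation borel := (borel_cube R).
Local Notation Omega := (Omega R).

Definition box n (B : nat -> set R) : set borel :=
  [set w | forall i, (i < n)%N -> B i (w i)%:num].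

Lemma measurable_box n (B : nat -> set R) :
  (forall i, measurable (B i)) -> measurable (box n B).
Proof.
move=> mB; rewrite (_ : box n B =
  \bigcap_(i in [set i | (i < n)%N]) ((fun w : borel => (w i)%:num) @^-1` B i)).
  by apply: bigcap_measurableType => i _;
    exact: measurable_preimage (@measurable_coord R i) (mB i).
by apply/seteqP; split=> w Bw i; exact: Bw.
Qed.

(** Boxes generate the Borel sets, and they are stable under intersection once
    the shorter box is padded with full factors. *)
Lemma eq_probability_box (P Q : probability borel R) :
  (forall n B, (forall i, measurable (B i)) -> P (box n B) = Q (box n B)) ->
  forall A, measurable A -> P A = Q A.
Proof.
move=> PQ A mA.
pose G : set (set borel) := [set X | exists n B,
  (forall i, measurable (B i)) /\ X = box n B].
apply: (@g_sigma_algebra_measure_unique _ _ _ G _ (fun=> setT) _ _ P Q).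
- by move=> _ [n [B [mB ->]]]; exact: measurable_box.
- move=> _; exists 0%N, (fun=> setT); split=> //.
  by apply/seteqP; split.
- by apply/seteqP; split=> // w _; exists 0%N.
- move=> _ _ [n [B [mB ->]]] [m [C [mC ->]]].
  exists (maxn n m), (fun i => (if (i < n)%N then B i else setT) `&`
                               (if (i < m)%N then C i else setT)); split.
    by move=> i; apply: measurableI; case: ifP.
  apply/seteqP; split=> [w [Bw Cw] i _|w BCw].
    by split; case: ifP => // im; [exact: Bw|exact: Cw].
  split=> i im; have [] := BCw i; rewrite ?leq_max ?im ?orbT//.
- by move=> _ [n [B [mB ->]]]; exact: PQ.
- by move=> _; rewrite (le_lt_trans (probability_le1 _ _)) ?ltry.
apply: smallest_sub mA; first exact: smallest_sigma_algebra.
move=> _ [n [B [mB ->]]]; apply: sub_sigma_algebra.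
exists n.+1, (fun i => if i == n then B else setT); split.
  by move=> i; case: ifP.
apply/seteqP; split=> w /=; first by move=> Bw i _; case: eqP => // ->.
by move=> /(_ n (ltnSn n)); rewrite eqxx.
Qed.

Lemma is_uniform_unique (P Q : probability Omega R) :
  is_uniform P -> is_uniform Q -> forall A, measurable A -> P A = Q A.
Proof.
move=> uP uQ; apply: eq_probability_Omega.
apply: (@eq_probability_box (borel_restr P) (borel_restr Q)) => n B mB.
by apply: etrans (uP n B mB) _; exact/esym/(uQ n B mB).
Qed.

(** One uniform number contains two independent ones: randomize the law of a
    pair of independent uniform numbers, stored in the cube. *)
Lemma unif01_split : exists S1 S2 : R -> R,
  [/\ measurable_fun [set: R] S1, measurable_fun [set: R] S2 &
    forall A B, measurable A -> measurable B ->
      unif01 R (S1 @^-1` A `&` S2 @^-1` B) = (unif01 R A * unif01 R B)%E].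
Proof.
pose e (p : measurableTypeR R * measurableTypeR R) : borel :=
  fun n => clamp (if n == 0%N then p.1 else p.2).
have me : measurable_fun setT e.
  apply: measurable_to_borel_cube => n.
  apply: (measurableT_comp (@measurable_clamp R)).
  by case: (n == 0%N); [exact: measurable_fst|exact: measurable_snd].
have [f mf fE] := randomization_borel (push (unif01 R \x unif01 R)%E me).
exists (fun x => (f x 0%N)%:num), (fun x => (f x 1%N)%:num); split.
- exact: (measurableT_comp (@measurable_coord R 0) mf).
- exact: (measurableT_comp (@measurable_coord R 1) mf).
move=> A B mA mB.
have mC n (C : set R) :
    measurable C -> measurable [set w : borel | C (w n)%:num].
  by move=> mC; exact: measurable_preimage (@measurable_coord R n) mC.
pose AB := [set w : borel | A (w 0%N)%:num] `&` [set w | B (w 1%N)%:num].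
rewrite [LHS](fE AB); last by apply: measurableI; exact: mC.
rewrite pushE -(unif01_clamp mA) -(unif01_clamp mB).
rewrite -product_measure1E//;
  exact: measurable_preimage (@measurable_clamp R) _.
Qed.

(** Split a uniform number, keep the first part, and split the second part
    again: the kept parts are independent and uniform. *)
Lemma is_uniform_exists : exists P : probability Omega R, is_uniform P.
Proof.
have [S1 [S2 [mS1 mS2 S12]]] := unif01_split.
pose W (x : R) : borel := fun n => clamp (S1 (iter n S2 x)).
have mW : measurable_fun [set: R] W.
  apply: measurable_to_borel_cube => n.
  apply: (measurableT_comp (@measurable_clamp R)).
  apply: (measurableT_comp mS1).
  elim: n => [|n IH] /=; first exact: measurable_id.
  exact: measurableT_comp mS2 IH.
exists (completion (push (unif01 R) mW)) => n B mB.
rewrite [LHS]completionE; last exact: measurable_box.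
rewrite pushE; elim: n B mB => [|n IH] B mB.
  rewrite big_ord0 (_ : _ @^-1` _ = setT) ?probability_setT//.
  by apply/seteqP; split.
(* A box constrains the first kept part and, through S2, the remaining ones by a
   shorter box; [S12] factors the two constraints. *)
rewrite big_ord_recl [X in (_ * X)%E](_ : _ =
  unif01 R (W @^-1` box n (fun i => B i.+1))); last by rewrite IH.
rewrite [X in (X * _)%E](esym (unif01_clamp (mB 0%N))).
rewrite -[RHS]S12; last 2 first.
- exact: measurable_preimage (@measurable_clamp R) (mB 0%N).
- by apply: (measurable_preimage mW); exact: measurable_box.
congr (unif01 R _); apply/seteqP; split=> x /= Bx.
  split=> [|i ni]; first exact: (Bx 0%N).
  by rewrite /W -iterSr; exact: (Bx i.+1).
case: Bx => B0 BS [_|i]; first exact: B0.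
by rewrite ltnS => /BS; rewrite /W -iterSr.
Qed.

Lemma Unif_uniform : is_uniform (Unif R).
Proof. exact: getPex is_uniform_exists. Qed.

(** The first coordinate of a uniform sample is a uniform number. *)
Theorem randomization (P : probability Omega R) :
  exists2 f : Omega -> Omega, measurable_fun [set: Omega] f &
    forall A, measurable A -> Unif R (f @^-1` A) = P A.
Proof.
have [f mf fE] := randomization_borel (borel_restr P).
pose F (w : Omega) : Omega := f (w 0%N)%:num.
have mF : measurable_fun [set: Omega] (F : Omega -> borel).
  apply: (measurableT_comp mf).
  exact: measurableT_comp (@measurable_coord R 0) (@measurable_Omega_borel R).
exists F; first exact: measurable_to_Omega.
apply: (@eq_probability_Omega _ (push _ (measurable_to_Omega mF))) => A mA.
apply: etrans (fE A mA); rewrite pushE.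
have mfA : measurable (f @^-1` A) by exact: measurable_preimage mf mA.
have := Unif_uniform 1 (fun=> mfA); rewrite big_ord1 => H; apply: etrans H.
congr (Unif R _); apply/seteqP; split=> w /= Aw; last exact: (Aw 0%N).
by case.
Qed.

End uniform.

(** * Rearranging samples *)

Section reindexing.
Variable R : realType.
Local Notation borel := (borel_cube R).
Local Notation Omega := (Omega R).

Lemma measurable_Omega_coord n :
  measurable_fun [set: Omega] (fun w : Omega => (w n)%:num : R).
Proof.
exact: measurableT_comp (@measurable_coord R n) (@measurable_Omega_borel R).
Qed.

Lemma measurable_Omega_coordP (f : Omega -> Omega) :
  (forall n, measurable_fun [set: Omega] (fun w => (f w n)%:num : R)) ->
  measurable_fun [set: Omega] f.
Proof. by move=> mf; apply/measurable_to_Omega/measurable_to_borel_cube. Qed.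

Definition reindex (s : nat -> nat) (w : Omega) : Omega := fun n => w (s n).

Lemma measurable_reindex s : measurable_fun [set: Omega] (reindex s).
Proof.
by apply: measurable_Omega_coordP => n; exact: measurable_Omega_coord.
Qed.

(** The coordinates of a uniform sample are exchangeable: any selection of
    distinct coordinates is again an independent uniform sequence. *)
Lemma Unif_reindex s A : injective s -> measurable A ->
  Unif R (reindex s @^-1` A) = Unif R A.
Proof.
move=> s_inj mA; rewrite -(pushE _ (measurable_reindex s)).
apply: is_uniform_unique mA; last exact: Unif_uniform.
move=> n B mB; rewrite pushE; pose m := (\max_(i < n) s i).+1.
have sm i : (i < n)%N -> (s i < m)%N.
  by move=> ni; rewrite ltnS (leq_bigmax (Ordinal ni)).
(* [C j] gathers the constraints that the box puts on the coordinate [j]; as [s]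
   is injective there is at most one. *)
pose C j := \bigcap_(i in [set i | (i < n)%N /\ s i = j]) B i.
have -> : reindex s @^-1` [set w | forall i, (i < n)%N -> B i (w i)%:num] =
    [set w | forall j, (j < m)%N -> C j (w j)%:num].
  apply/seteqP; split=> w /= Bw; first by move=> j _ i [ni <-]; exact: Bw.
  by move=> i ni; apply: Bw (sm _ ni) _ _; split.
rewrite Unif_uniform => [|j]; last by apply: bigcap_measurableType => i _.
pose p (i : 'I_n) : 'I_m := Ordinal (sm i (ltn_ord i)).
rewrite [RHS](partition_big p xpredT)//=; apply: eq_bigr => j _.
case: (pickP (fun i => p i == j)) => [i /eqP pij|p0]; last first.
  rewrite big_pred0// (_ : C j = setT) ?probability_setT//.
  apply/seteqP; split=> // x _ i [ni sij].
  by have /eqP[] := p0 (Ordinal ni); exact/val_inj.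
rewrite (big_pred1 i) => [|i']; last first.
  by rewrite -pij; apply/eqP/eqP => [[/s_inj/val_inj]|->].
congr (uniform_prob _ _); apply/seteqP; split=> x; first by apply; rewrite -pij.
by move=> Bx k [_ sk]; rewrite (s_inj k i)// sk -pij.
Qed.

(** The halves of [Theta], as folded constants: as pairs of functions they
    would be expanded by simplification and [theta1K] could not be used. *)
Definition theta1 (w : Omega) : Omega := (Theta w).1.
Definition theta2 (w : Omega) : Omega := (Theta w).2.

Lemma theta1K (w w' : Omega) : theta1 (Theta_inv (w, w')) = w.
Proof. by rewrite /theta1 Theta_invK. Qed.

Lemma theta2K (w w' : Omega) : theta2 (Theta_inv (w, w')) = w'.
Proof. by rewrite /theta2 Theta_invK. Qed.

Lemma measurable_theta1 : measurable_fun [set: Omega] theta1.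
Proof. exact: (measurable_reindex double). Qed.

Lemma measurable_theta2 : measurable_fun [set: Omega] theta2.
Proof. exact: (measurable_reindex (fun n => n.*2.+1)). Qed.

End reindexing.
Arguments theta1 : simpl never.
Arguments theta2 : simpl never.

(** * Slices and the exchange of integrals *)

Section fubini.
Variable R : realType.
Local Notation borel := (borel_cube R).
Local Notation Omega := (Omega R).
Local Notation U := (Unif R).
Local Open Scope ereal_scope.

Definition slice (A : set Omega) (w : Omega) : set Omega :=
  [set w' | A (Theta_inv (w, w'))].

Lemma measurable_mix : measurable_fun [set: borel * borel]
  (@Theta_inv R : borel * borel -> borel).
Proof.
apply: measurable_to_borel_cube => n; rewrite /Theta_inv.
case: (odd n); apply: (measurableT_comp (@measurable_coord R _)).
  exact: measurable_snd.
exact: measurable_fst.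
Qed.

Lemma measurable_Theta_inv (f g : Omega -> Omega) :
  measurable_fun [set: Omega] f -> measurable_fun [set: Omega] g ->
  measurable_fun [set: Omega] (fun w => Theta_inv (f w, g w) : Omega).
Proof.
move=> mf mg; apply: measurable_Omega_coordP => n; rewrite /Theta_inv/=.
by case: (odd n); apply: (measurableT_comp (@measurable_Omega_coord R _)).
Qed.

Lemma measurable_slice (A : set Omega) w :
  measurable A -> measurable (slice A w).
Proof.
move=> mA; apply: (measurable_preimage _ mA).
by apply: measurable_Theta_inv => //; exact: measurable_cst.
Qed.

Section section_law.
Variables (P : probability borel R) (Q : probability Omega R).

(** The law of the interleaving of independent samples of P and of Q. *)
Definition mix_law : probability borel R :=
  push (P \x borel_restr Q) measurable_mix.

Lemma mix_lawE (B : set borel) : mix_law B = \int[P]_w Q (slice B w).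
Proof.
rewrite /mix_law pushE; apply: eq_integral => w _ /=.
congr (Q _); apply/seteqP; split=> w'; rewrite /slice/= /xsection/= ?inE//.
Qed.

Lemma measurable_slice_borel (B : set borel) : measurable B ->
  measurable_fun [set: borel] (fun w : borel => Q (slice B w)).
Proof.
move=> mB; have := measurable_fun_xsection (borel_restr Q)
  (measurable_preimage measurable_mix mB).
congr (measurable_fun _ _); apply/funext => w /=; congr (Q _).
by apply/seteqP; split=> w'; rewrite /slice/= /xsection/= ?inE.
Qed.

End section_law.

(** Squeeze [A] with respect to the interleaving of P and Q. The slices of the
    two bounds differ by a Q-null set except over a P-null Borel set [N] of
    base points; off [N] the measure of the slice of [A] is a Borel function.
    *)
Lemma measurable_fun_slice (Q : probability Omega R) (A : set Omega) :
  measurable A -> measurable_fun [set: Omega] (fun w => Q (slice A w)).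
Proof.
move=> mA _ Y mY; rewrite setTI; apply: universally_measurable_sandwich => P.
have [B [C [mB mC BA AC PCB]]] :=
  (universally_measurableP A).1 mA (mix_law P Q).
have mCB : measurable (C `\` B : set borel) by exact: measurableD.
have mB' := borel_Omega_measurable mB; have mC' := borel_Omega_measurable mC.
pose N := [set w : borel | Q (slice (C `\` B) w) != 0].
have mN : measurable N.
  rewrite /N -[X in measurable X]setTI.
  by apply: emeasurable_neq => //; exact: measurable_slice_borel.
have PN : P N = 0.
  move: PCB; rewrite mix_lawE.
  have -> : \int[P]_w Q (slice (C `\` B) w) =
      \int[P]_w `|Q (slice (C `\` B) w)|.
    by apply: eq_integral => w _; rewrite gee0_abs.
  have mQ := measurable_slice_borel Q mCB.
  move=> /(ae_eq_integral_abs P measurableT mQ).1[M [mM PM NM]].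
  apply/eqP; rewrite -measure_le0 -PM le_measure ?inE//.
  by move=> w /= Nw; apply: NM => /= /(_ Logic.I)/eqP; exact/negP.
have mY' : measurable ((fun w : borel => Q (slice B w)) @^-1` Y).
  exact: measurable_preimage (measurable_slice_borel Q mB) mY.
have QN w : ~ N w -> Q (slice A w) = Q (slice B w).
  move=> /negP/negPn/eqP Nw; apply/esym.
  have CBw : Q (slice C w) = Q (slice B w).
    by apply: null_setD_eq => //;
      [exact: measurable_slice|exact: measurable_slice|move=> w' /BA/AC].
  apply/eqP; rewrite eq_le -{2}CBw !le_measure ?inE//;
    try exact: measurable_slice.
  + by move=> w' /AC.
  + by move=> w' /BA.
exists ((fun w => Q (slice B w)) @^-1` Y `\` N),
  ((fun w => Q (slice B w)) @^-1` Y `|` N); split.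
- by apply: borel_Omega_measurable; exact: measurableD.
- by apply: borel_Omega_measurable; exact: measurableU.
- by move=> w [Yw Nw]; rewrite /= QN.
- move=> w /= Yw; have [Nw|Nw] := pselect (N w); first by right.
  by left; rewrite /= -QN.
- rewrite [LHS]completionE; last by apply: measurableD;
    [exact: measurableU|exact: measurableD].
  apply/eqP; rewrite -measure_le0 -PN le_measure ?inE//.
    by apply: measurableD; [exact: measurableU|exact: measurableD].
  by move=> w [[Yw|//] nYN]; apply: contrapT => Nw; apply: nYN.
Qed.

Lemma prod_even_odd (F : nat -> \bar R) n :
  \prod_(i < n.*2) F i = \prod_(k < n) F k.*2 * \prod_(k < n) F k.*2.+1.
Proof.
elim: n => [|n IH]; first by rewrite !big_ord0 mule1.
by rewrite doubleS !big_ord_recr/= IH muleACA -!muleA.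
Qed.

(** A box of even length is a box on the even coordinates times a box on the
    odd ones. *)
Lemma mix_law_Unif (B : set borel) : measurable B ->
  mix_law (borel_restr U) U B = U B.
Proof.
apply: (@eq_probability_box R (mix_law (borel_restr U) U) (borel_restr U)).
move=> {B} n B' mB'; pose B i := if (i < n)%N then B' i else setT.
have mB i : measurable (B i) by rewrite /B; case: ifP.
(* Padding with full factors makes the length even. *)
have -> : box n B' = box n.*2 B.
  apply/seteqP; split=> w Bw i ni; first by rewrite /B; case: ifP => // /Bw.
  have := Bw i; rewrite /B ni; apply; rewrite -addnn; exact: ltn_addr.
rewrite /mix_law pushE.
pose B0 k := B k.*2; pose B1 k := B k.*2.+1.
have mB0 k : measurable (B0 k) by exact: mB.
have mB1 k : measurable (B1 k) by exact: mB.
rewrite (_ : _ @^-1` _ = box n B0 `*` box n B1).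
  apply: etrans (product_measure1E (borel_restr U) (borel_restr U)
    (measurable_box _ mB0) (measurable_box _ mB1)) _.
  have UE (C : nat -> set R) m : (forall i, measurable (C i)) ->
      borel_restr U (box m C) = \prod_(i < m) unif01 R (C i).
    by move=> mC; exact: Unif_uniform.
  rewrite /= !UE//.
  by rewrite (prod_even_odd (fun i => unif01 R (B i))).
apply/seteqP; split=> [[w w'] Bw|[w w'] [/= Bw Bw'] i ni] /=.
  split=> k kn /=; [have := Bw k.*2|have := Bw k.*2.+1];
    rewrite /Theta_inv/= odd_double/= ?doubleK ?uphalf_double; apply; lia.
rewrite /Theta_inv/=; case: ifPn => oi.
  have := Bw' i./2; rewrite /B1 -[in B _](_ : i = i./2.*2.+1); last lia.
  apply; lia.
have := Bw i./2; rewrite /B0 -[in B _](_ : i = i./2.*2); last lia.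
apply; lia.
Qed.

(** Both sides are monotone in [A], and they agree on the Borel bounds of a
    squeezed set. *)
Theorem fubini_Unif (A : set Omega) : measurable A ->
  \int[U]_w U (slice A w) = U A.
Proof.
move=> mA.
have [B [C [mB mC BA AC PCB]]] :=
  (universally_measurableP A).1 mA (borel_restr U).
have mB' := borel_Omega_measurable mB; have mC' := borel_Omega_measurable mC.
have intE (D : set borel) : measurable D -> \int[U]_w U (slice D w) = U D.
  move=> mD; rewrite -(mix_law_Unif mD) mix_lawE.
  by rewrite (ge0_integral_pushforward (@measurable_Omega_borel R))//;
    exact: measurable_slice_borel.
have UCB : U C = U B by exact: null_setD_eq (subset_trans BA AC) PCB.
have UAB : U A = U B.
  apply/eqP; rewrite eq_le -{1}UCB !le_measure ?inE//.
rewrite UAB; apply/eqP; rewrite eq_le -{1}UCB -(intE C)// -(intE B)//.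
apply/andP; split; apply: ge0_le_integral => //;
  try exact: measurable_fun_slice.
- move=> w _; rewrite le_measure ?inE//; try exact: measurable_slice.
  by move=> w' /AC.
- move=> w _; rewrite le_measure ?inE//; try exact: measurable_slice.
  by move=> w' /BA.
Qed.

(** Exchanging the coordinates [2k] and [2k + 1] exchanges the two halves. *)
Lemma fubini_swap (A : set Omega) : measurable A ->
  \int[U]_w U (slice A w) = \int[U]_w' U [set w | A (Theta_inv (w, w'))].
Proof.
move=> mA; pose s n := if odd n then n.-1 else n.+1.
have s_inj : injective s by rewrite /s => i j; case: ifPn; case: ifPn; lia.
rewrite fubini_Unif// -(Unif_reindex s_inj mA) -fubini_Unif; last first.
  exact: measurable_preimage (@measurable_reindex R s) mA.
apply: eq_integral => w' _; congr (U _).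
suff sE w : reindex s (Theta_inv (w', w)) = Theta_inv (w, w').
  by apply/seteqP; split=> w; rewrite /slice/= sE.
apply/funext => n; rewrite /reindex /s /Theta_inv/=.
case: (boolP (odd n)) => on.
  have -> : odd n.-1 = false by lia.
  by congr w'; lia.
have -> : odd n.+1 by lia.
by congr w; lia.
Qed.

(** Turns a sample bracketed as [(w1, (w2, w3))] into [((w1, w2), w3)]. *)
Definition reassociate (w : Omega) : Omega :=
  Theta_inv (Theta_inv (theta1 w, theta1 (theta2 w)), theta2 (theta2 w)).

Lemma measurable_reassociate : measurable_fun [set: Omega] reassociate.
Proof.
have t1 : measurable_fun [set: Omega] (@theta1 R) by exact: measurable_theta1.
have t2 : measurable_fun [set: Omega] (@theta2 R) by exact: measurable_theta2.
apply: measurable_Theta_inv; last exact: (measurableT_comp t2 t2).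
by apply: measurable_Theta_inv; last exact: measurableT_comp t1 t2.
Qed.

Lemma Unif_reassociate (A : set Omega) : measurable A ->
  U (reassociate @^-1` A) = U A.
Proof.
(* w3 occupies the coordinates 4k + 3 of [w] and becomes the odd half; w2 moves
   from 4k + 1 to 4k + 2, and w1 from 2k to 4k. *)
move=> mA; pose s n := if odd n then n.*2.+1 else
  if odd n./2 then n.-1 else n./2.
have s_inj : injective s.
  rewrite /s => i j; case: (boolP (odd i)) => oi; case: (boolP (odd j)) => oj;
    case: (boolP (odd i./2)) => oi2; case: (boolP (odd j./2)) => oj2; lia.
rewrite -(Unif_reindex s_inj mA); congr (U (_ @^-1` A)); apply/funext => w.
apply/funext => n.
rewrite /reindex /s /reassociate /Theta_inv /theta1 /theta2 /Theta/=.
by case: ifPn => on; [|case: ifPn => on2]; congr w; lia.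
Qed.

End fubini.

(** * Reparametrization of plots *)

Section site.
Variable R : realType.
Local Notation Omega := (Omega R).

Lemma smooth_cst m n (v : 'rV[R]_n) : smooth (fun _ : 'rV[R]_m => v).
Proof.
have partial_cst (s : seq 'I_m) :
    exists u : 'rV[R]_n, partial s (fun=> v) = (fun=> u).
  elim: s => [|i s [u IH]] /=; first by exists v.
  by exists 0; rewrite IH; apply/funext => x; exact: derive_cst.
move=> s; have [u ->] := partial_cst s.
by split=> [x|i x]; [exact: cst_continuous|exact: derivable_cst].
Qed.

Lemma smooth_id n : smooth (fun x : 'rV[R]_n => x).
Proof.
(* Every iterated partial derivative of the identity satisfies [P]. *)
pose P (f : 'rV[R]_n -> 'rV[R]_n) :=
  f = (fun x => x) \/ exists u, f = (fun=> u).
have DP (i : 'I_n) f : P f -> P (fun x => 'D_(delta_mx 0 i) f x).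
  case=> [->|[u ->]]; right; [exists (delta_mx 0 i)|exists 0];
    apply/funext => x; [exact: derive_id|exact: derive_cst].
move=> s; have : P (partial s (fun x => x)).
  by elim: s => [|i s IH]; [left|exact: DP].
case=> [->|[u ->]].
  by split=> [x|i x]; [exact: cvg_id|exact: derivable_id].
by split=> [x|i x]; [exact: cst_continuous|exact: derivable_cst].
Qed.

Lemma mixed_smooth_fst n : mixed_smooth (fst : site R n -> 'rV[R]_n).
Proof. by split=> [w|t]; [exact: smooth_id|exact: measurable_cst]. Qed.

Lemma mixed_smooth_cst m n (v : 'rV[R]_n) :
  mixed_smooth (fun _ : site R m => v).
Proof. by split=> [w|t]; [exact: smooth_cst|exact: measurable_cst]. Qed.

(** All reparametrizations that are used have this form: [F] feeds one part of
    the sample to the deterministic component. *)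
Lemma site_hom_pair m n (g : site R m -> 'rV[R]_n) (F G : Omega -> Omega) :
  mixed_smooth g -> measurable_fun [set: Omega] F ->
  measurable_fun [set: Omega] G ->
  site_hom (fun z : site R m => (g (z.1, F z.2), G z.2) : site R n).
Proof.
move=> [sg mg] mF mG; exists (fun z => g (z.1, F z.2)), G.
split; [|exact: mG|by []].
by split=> [w|t]; [exact: (sg (F w))|exact: measurableT_comp (mg t) mF].
Qed.

End site.

Section plots.
Variables (R : realType) (X : sss R).
Local Notation Omega := (Omega R).
Local Notation U := (Unif R).
Implicit Types (F G : Omega -> Omega).

Lemma plot_comp m n (p : site R n -> X) (h : site R m -> site R n) :
  plot p -> site_hom h -> plot (p \o h).
Proof. exact: (sssP X).2. Qed.

Lemma plot_reparam n (p : site R n -> X) F :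
  plot p -> measurable_fun [set: Omega] F -> plot (fun z => p (z.1, F z.2)).
Proof.
move=> pp mF; apply: (plot_comp pp (h := fun z => (z.1, F z.2))).
exact: (site_hom_pair (@mixed_smooth_fst R n) mF mF).
Qed.

Lemma plot_freeze n (p : site R n -> X) t F :
  plot p -> measurable_fun [set: Omega] F -> plot0 (fun w => p (t, F w)).
Proof.
move=> pp mF; apply: (plot_comp pp (h := fun z : site R 0 => (t, F z.2))).
exact: (site_hom_pair (@mixed_smooth_cst R 0 n t) mF mF).
Qed.

Lemma plot_of_plot0 n (xi : Omega -> X) F :
  plot0 xi -> measurable_fun [set: Omega] F ->
  plot (fun z : site R n => xi (F z.2)).
Proof.
move=> pxi mF.
apply: (plot_comp pxi (h := fun z : site R n => (0, F z.2) : site R 0)).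
exact: (site_hom_pair (@mixed_smooth_cst R n 0 0) mF mF).
Qed.

Lemma plot0_comp (xi : Omega -> X) F :
  plot0 xi -> measurable_fun [set: Omega] F -> plot0 (xi \o F).
Proof. exact: plot_of_plot0. Qed.

Lemma plot0_cst (x : X) : plot0 (cst x : Omega -> X).
Proof. exact: (sssP X).1. Qed.

Lemma plot0_preimage (xi : Omega -> X) (A : set X) :
  plot0 xi -> induced_sigma X A -> measurable (xi @^-1` A).
Proof. by move=> pxi; exact. Qed.

End plots.

(** * The space of measures *)

Section image_measure.
Variable R : realType.
Local Notation Omega := (Omega R).
Local Notation U := (Unif R).

Lemma image_measureE (T : Type) (X : plotted R) (f : T -> X) mu (A : set X) :
  induced_sigma X A -> image_measure f mu A = mu (f @^-1` A).
Proof. by move=> mA; rewrite /image_measure asboolT. Qed.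

Lemma eq_image_measure (T T' : Type) (X : plotted R) (f : T -> X) mu
    (f' : T' -> X) mu' :
  (forall A, induced_sigma X A -> mu (f @^-1` A) = mu' (f' @^-1` A)) ->
  image_measure f mu = image_measure f' mu'.
Proof.
move=> ff'; apply/funext => A; rewrite /image_measure.
by case: asboolP => // /ff'.
Qed.

Lemma measures_val_inj (X : plotted R) (mu nu : measures X) :
  measure_val mu = measure_val nu -> mu = nu.
Proof.
case: mu nu => [mu muP] [nu nuP] /= munu; subst nu.
by congr Measures; exact: Prop_irrelevance.
Qed.

Lemma eq_measures (X : plotted R) (mu nu : measures X) :
  (forall A, induced_sigma X A -> mu A = nu A) -> mu = nu.
Proof.
move=> munu; apply: measures_val_inj.
have [xi [P [_ muE]]] := measure_valP mu.
have [eta [Q [_ nuE]]] := measure_valP nu.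
rewrite muE nuE; apply: eq_image_measure => A mA.
by rewrite -image_measureE// -muE munu// nuE image_measureE.
Qed.

Definition law (X : plotted R) (xi : Omega -> X) (pxi : plot0 xi) :
    measures X :=
  Measures (ex_intro _ xi (ex_intro _ (Unif R) (conj pxi erefl))).

(** [randomization] absorbs the sampling law into the random element, so that
    U alone represents all measures. *)
Lemma measures_law (X : sss R) (mu : measures X) : exists xi : Omega -> X,
  plot0 xi /\ measure_val mu = image_measure xi U.
Proof.
have [xi [P [pxi muE]]] := measure_valP mu.
have [F mF FE] := randomization P.
exists (xi \o F); split; first exact: plot0_comp.
rewrite muE; apply: eq_image_measure => A mA.
by rewrite comp_preimage FE//; exact: plot0_preimage.
Qed.

Lemma induced_sigma_preimage (X Y : plotted R) (f : X -> Y) (A : set Y) :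
  is_sss_map f -> induced_sigma Y A -> induced_sigma X (f @^-1` A).
Proof. by move=> mf mA xi pxi; exact: (mA _ (mf _ _ pxi)). Qed.

Lemma image_measure_comp (T : Type) (X Y : plotted R) (f : X -> Y) (g : T -> X)
    mu : is_sss_map f ->
  image_measure f (image_measure g mu) = image_measure (f \o g) mu.
Proof.
move=> mf; apply: eq_image_measure => A mA.
by rewrite image_measureE//; exact: induced_sigma_preimage.
Qed.

Lemma sample_lawE (X : plotted R) n (Y : site R n -> X) z A :
  induced_sigma X A ->
  sample_law Y z A = U [set w | A (Y (z.1, Theta_inv (z.2, w)))].
Proof. by move=> mA; rewrite /sample_law image_measureE. Qed.

(** A constant measure is sampled from the fresh half alone; a
    reparametrization acts on the first half and passes the fresh half on. *)
Lemma measures_sample_smooth (X : sss R) : sample_smooth (measures_plotted X).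
Proof.
split=> [n mu|m n p h [Y [pY pE]] [g [F [sg mF ->]]]].
  have [xi [pxi muE]] := measures_law mu.
  exists (fun z => xi (theta2 z.2)); split.
    exact: plot_of_plot0 pxi (@measurable_theta2 R).
  move=> z; rewrite /= muE; apply: eq_image_measure => A mA.
  by congr (U _); apply/seteqP; split=> w' /=; rewrite theta2K.
pose G w := Theta_inv (F (theta1 w), theta2 w).
have mG : measurable_fun [set: Omega] G.
  apply: measurable_Theta_inv; last exact: measurable_theta2.
  exact: measurableT_comp mF (@measurable_theta1 R).
exists (fun z => Y (g (z.1, theta1 z.2), G z.2)); split.
  apply: (plot_comp pY (h := fun z => (g (z.1, theta1 z.2), G z.2))).
  exact: site_hom_pair sg (@measurable_theta1 R) mG.
move=> [t w]; rewrite pE; apply: eq_image_measure => A mA /=.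
by congr (U _); apply/seteqP; split=> w' /=; rewrite /G theta1K theta2K.
Qed.

Definition PX (X : sss R) : sss R := Sss (measures_sample_smooth X).

End image_measure.

(** * Functor, unit, multiplication and strength *)

Section structure_maps.
Variable R : realType.
Local Notation Omega := (Omega R).
Local Notation U := (Unif R).
Implicit Types X Y : sss R.

Definition push_measures X Y (f : sss_map X Y) (mu : measures X) : measures Y.
Proof.
refine (@Measures _ _ (image_measure f mu) _).
have [xi [P [pxi muE]]] := measure_valP mu; exists (f \o xi), P; split.
  exact: (sss_funP f pxi).
by rewrite muE image_measure_comp//; exact: sss_funP.
Defined.

Lemma push_measuresE X Y (f : sss_map X Y) mu A : induced_sigma Y A ->
  push_measures f mu A = mu (f @^-1` A).
Proof. exact: image_measureE. Qed.

Lemma push_measures_law X Y (f : sss_map X Y) mu (xi : Omega -> X) :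
  measure_val mu = image_measure xi U ->
  measure_val (push_measures f mu) = image_measure (f \o xi) U.
Proof. by move=> muE; rewrite /= muE image_measure_comp//; exact: sss_funP. Qed.

Lemma push_measures_sss X Y (f : sss_map X Y) :
  @is_sss_map R (PX X) (PX Y) (push_measures f).
Proof.
move=> n p [Z [pZ pE]]; exists (f \o Z); split; first exact: (sss_funP f pZ).
by move=> z; rewrite /= pE image_measure_comp//; exact: sss_funP.
Qed.

Definition Pmap X Y (f : sss_map X Y) : sss_map (PX X) (PX Y) :=
  SssMap (@push_measures_sss X Y f).

Definition point_mass X (x : X) : measures X := law (plot0_cst x).

Lemma point_massE X (x : X) A : induced_sigma X A ->
  point_mass x A = (\1_A x)%:E.
Proof.
move=> mA; rewrite /= image_measureE// preimage_cst indicE.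
by case: ifPn => xA; rewrite ?probability_setT ?measure0.
Qed.

(** The point mass at [p z] is sampled by ignoring the fresh half. *)
Lemma point_mass_sss X : @is_sss_map R X (PX X) (@point_mass X).
Proof.
move=> n p pp; exists (fun z => p (z.1, theta1 z.2)); split.
  exact: plot_reparam pp (@measurable_theta1 R).
move=> [t w] /=; apply: eq_image_measure => A mA.
by congr (U _); apply/seteqP; split=> w'; rewrite /= theta1K.
Qed.

Definition dirac_map X : sss_map X (PX X) := SssMap (@point_mass_sss X).

Lemma plot_measures n X (p : site R n -> PX X) : plot p ->
  exists Y : site R n -> X, plot Y /\ forall z A, induced_sigma X A ->
    (p z : measures X) A = U [set w | A (Y (z.1, Theta_inv (z.2, w)))].
Proof.
by move=> [Y [pY pE]]; exists Y; split=> // z A mA; rewrite pE sample_lawE.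
Qed.

(** A random measure is a random element of X whose sample is frozen in its
    first half: its values are measures of slices. *)
Lemma plot0_measures X (xi : Omega -> PX X) : plot0 xi ->
  exists eta : Omega -> X, plot0 eta /\ forall w A, induced_sigma X A ->
    (xi w : measures X) A = U (slice (eta @^-1` A) w).
Proof.
move=> /plot_measures[Y [pY pE]]; exists (fun w => Y (0, w)); split.
  exact: plot_freeze pY (@measurable_id _ _ _).
by move=> w A mA; have := pE (0, w) A mA.
Qed.

Lemma measurable_eval X (xi : Omega -> PX X) A :
  plot0 xi -> induced_sigma X A ->
  measurable_fun [set: Omega] (fun w => (xi w : measures X) A).
Proof.
move=> /plot0_measures[eta [peta xiE]] mA.
rewrite (_ : (fun w => _) = (fun w => U (slice (eta @^-1` A) w))).
  by apply: measurable_fun_slice; exact: plot0_preimage.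
by apply/funext => w; exact: xiE.
Qed.

(** Off B_X the set function [image_measure xi U] is 0, so it is not literally
    a pushforward; it is a measure on B_X that agrees with one there. *)
Section integral_image_measure.
Variables (X : plotted R) (x0 : X) (xi : Omega -> X).
Hypothesis pxi : plot0 xi.
Local Open Scope ereal_scope.

Let m : set (induced_space x0) -> \bar R := image_measure xi U.

Let mxi : measurable_fun [set: Omega] (xi : Omega -> induced_space x0).
Proof. by move=> _ A mA; rewrite setTI; exact: mA. Qed.

Let mE (A : set (induced_space x0)) : measurable A -> m A = push U mxi A.
Proof. exact: image_measureE. Qed.

Let m0 : m set0 = 0.
Proof. by rewrite mE ?measure0. Qed.

Let m_ge0 A : 0 <= m A.
Proof. by rewrite /m /image_measure; case: asboolP. Qed.

Let m_sigma_additive : semi_sigma_additive m.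
Proof.
move=> F mF tF mUF; rewrite mE//.
rewrite (_ : (fun n => _) = (fun n => \sum_(0 <= i < n) push U mxi (F i))).
  exact: (measure_semi_sigma_additive (s := push U mxi)).
by apply/funext => n; apply: eq_bigr => i _; exact: mE.
Qed.

HB.instance Definition _ := isMeasure.Build _ _ _ m m0 m_ge0 m_sigma_additive.

Lemma integral_image_measure (f : induced_space x0 -> \bar R) :
  measurable_fun [set: induced_space x0] f -> (forall x, 0 <= f x) ->
  \int[(image_measure xi U : set (induced_space x0) -> \bar R)]_x f x =
  \int[U]_w f (xi w).
Proof.
move=> mf f0; rewrite -[LHS]/(\int[m]_x f x).
rewrite (eq_measure_integral (push U mxi)); last by move=> A mA _; exact: mE.
by rewrite (ge0_integral_pushforward mxi).
Qed.

End integral_image_measure.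

Lemma integral_eval X (Gamma : measures (PX X)) (nu0 : PX X)
    (xi : Omega -> PX X) A :
  plot0 xi -> measure_val Gamma = image_measure xi U -> induced_sigma X A ->
  (\int[(Gamma : set (induced_space nu0) -> \bar R)]_nu (nu : measures X) A =
   \int[U]_w (xi w : measures X) A)%E.
Proof.
move=> pxi GE mA; rewrite GE.
apply: (@integral_image_measure (PX X) nu0 xi pxi
  (fun nu => (nu : measures X) A)).
  move=> _ Y mY; rewrite setTI.
  suff : @induced_sigma R (PX X) ((fun nu : measures X => nu A) @^-1` Y) by [].
  move=> eta peta.
  exact: measurable_preimage (measurable_eval peta mA) mY.
move=> nu; have [eta [_ nuE]] := measures_law (nu : measures X).
by rewrite nuE image_measureE.
Qed.

(** By [integral_eval] the value does not depend on the representation of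
    [Gamma]; and if [xi] is sampled by [eta], then the law of [eta] is the
    mixture, by [fubini_Unif]. *)
Lemma mixture_exists X (Gamma : measures (PX X)) : exists mu : measures X,
  forall xi, plot0 xi -> measure_val Gamma = image_measure xi U ->
  forall A, induced_sigma X A -> mu A = (\int[U]_w (xi w : measures X) A)%E.
Proof.
have [xi [pxi GE]] := measures_law Gamma.
have [eta [peta xiE]] := plot0_measures pxi.
exists (law peta) => zeta pzeta GE' A mA.
rewrite -(integral_eval (xi point) pzeta GE' mA) (integral_eval _ pxi GE mA).
rewrite /= image_measureE// -fubini_Unif; last exact: plot0_preimage.
by apply: eq_integral => w _; rewrite xiE.
Qed.

Definition mixture X (Gamma : measures (PX X)) : measures X :=
  projT1 (cid (mixture_exists Gamma)).

Lemma mixtureE X (Gamma : measures (PX X)) (xi : Omega -> PX X) A :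
  plot0 xi -> measure_val Gamma = image_measure xi U -> induced_sigma X A ->
  mixture Gamma A = (\int[U]_w (xi w : measures X) A)%E.
Proof.
move=> pxi GE mA; rewrite /mixture; case: cid => mu /= muE.
exact: muE pxi GE A mA.
Qed.

(** A plot of P(P(X)) comes from a plot of X whose sample is bracketed as a
    base sample, a first fresh one and a second fresh one. The mixture
    regroups the two fresh samples into one. *)
Lemma mixture_sss X : @is_sss_map R (PX (PX X)) (PX X) (@mixture X).
Proof.
move=> n p [Z [pZ pE]]; have [Y [pY ZE]] := plot_measures pZ.
have mF := @measurable_reassociate R.
exists (fun z => Y (z.1, reassociate z.2)); split.
  exact: plot_reparam pY mF.
move=> [t w].
have mw : measurable_fun [set: Omega] (fun w' => Theta_inv (w, w') : Omega).
  by apply: measurable_Theta_inv => //; exact: measurable_cst.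
pose mu : measures X := law (plot_freeze t pY (measurableT_comp mF mw)).
transitivity (measure_val mu); last by []; congr measure_val.
apply: eq_measures => A mA.
rewrite (mixtureE (xi := fun w' => Z (t, Theta_inv (w, w'))) _ (pE (t, w)))//.
  pose D : set Omega := [set v | A (Y (t, reassociate (Theta_inv (w, v))))].
  have mD : measurable D.
    exact: plot0_preimage (plot_freeze t pY (measurableT_comp mF mw)) mA.
  rewrite /mu /= image_measureE// -[RHS](fubini_Unif mD).
  apply: eq_integral => w' _; rewrite ZE//; congr (U _).
  by apply/seteqP; split=> w'';
    rewrite /slice/= /D/= /reassociate !(theta1K, theta2K).
exact: plot_freeze pZ mw.
Qed.

Definition join_map X : sss_map (PX (PX X)) (PX X) := SssMap (@mixture_sss X).

Definition pair_map X Y (x : X) : sss_map Y (sss_prod X Y).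
Proof.
refine (@SssMap _ _ (sss_prod X Y) (fun y => (x, y))
  (fun n p pp => conj _ pp)).
exact: (sssP X).1.
Defined.

(** The product of the point mass at [x] with [nu], as an image of [nu]: this
    form involves no representation of either factor. *)
Definition tensor X Y (p : X * measures Y) : measures (sss_prod X Y) :=
  push_measures (pair_map Y p.1) p.2.

Lemma tensorE X Y (x : X) (nu : measures Y) C :
  induced_sigma (sss_prod X Y) C ->
  tensor (x, nu) C = nu [set y | C (x, y)].
Proof. exact: push_measuresE. Qed.

(** The point is sampled from the first half and the measure uses both. *)
Lemma tensor_sss X Y :
  @is_sss_map R (sss_prod X (PX Y)) (PX (sss_prod X Y)) (@tensor X Y).
Proof.
move=> n p [p1 [Z [pZ pE]]].
exists (fun z => ((p (z.1, theta1 z.2)).1, Z z)); split.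
  by split; [exact: (plot_reparam p1 (@measurable_theta1 R))|].
move=> [t w]; rewrite /tensor /= [X in image_measure _ X](pE (t, w)).
rewrite image_measure_comp; last exact: (sss_funP (pair_map Y (p (t, w)).1)).
apply: (@eq_image_measure R _ _ (sss_prod X Y)) => C mC.
by congr (U _); apply/seteqP; split=> w'; rewrite /= theta1K.
Qed.

Definition strength_map X Y : sss_map (sss_prod X (PX Y)) (PX (sss_prod X Y)) :=
  SssMap (@tensor_sss X Y).

End structure_maps.

(** * The laws on measures *)

Section laws.
Variable R : realType.
Local Notation Omega := (Omega R).
Local Notation U := (Unif R).
Implicit Types X Y Z : sss R.
Local Open Scope ereal_scope.

(** The Kleisli extension of [g]. All the laws below that involve a mixture of
    an image are computed with it. *)
Lemma mixture_pushE Z X (g : sss_map Z (PX X)) (mu : measures Z)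
    (xi : Omega -> Z) A : plot0 xi -> measure_val mu = image_measure xi U ->
  induced_sigma X A ->
  mixture (push_measures g mu) A = \int[U]_w (g (xi w) : measures X) A.
Proof.
move=> pxi muE mA.
exact: mixtureE (sss_funP g pxi) (push_measures_law g muE) mA.
Qed.

Lemma push_measures_natural_point X Y (f : sss_map X Y) x :
  point_mass (f x) = push_measures f (point_mass x).
Proof.
apply: eq_measures => A mA; have mfA := induced_sigma_preimage (sss_funP f) mA.
by rewrite push_measuresE// !point_massE// !indicE.
Qed.

Lemma mixture_natural X Y (f : sss_map X Y) (Gamma : measures (PX X)) :
  mixture (push_measures (Pmap f) Gamma) = push_measures f (mixture Gamma).
Proof.
have [xi [pxi GE]] := measures_law Gamma; apply: eq_measures => A mA.
have mfA := induced_sigma_preimage (sss_funP f) mA.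
rewrite push_measuresE// (mixture_pushE _ pxi GE mA) (mixtureE pxi GE mfA).
by apply: eq_integral => w _; exact: push_measuresE.
Qed.

Lemma integral_Unif_cst (c : \bar R) : 0 <= c -> \int[U]__ c = c.
Proof.
by move=> c0; rewrite integral_cst//= probability_setT mule1.
Qed.

Lemma measures_ge0 X (mu : measures X) A : 0 <= mu A.
Proof.
have [xi [_ ->]] := measures_law mu; rewrite /image_measure.
by case: asboolP.
Qed.

Lemma mixture_point_mass X (mu : measures X) :
  mixture (@point_mass R (PX X) mu) = mu.
Proof.
apply: eq_measures => A mA.
rewrite (mixtureE (Gamma := @point_mass R (PX X) mu)
  (plot0_cst (mu : PX X)) erefl mA)/=.
by rewrite integral_Unif_cst// measures_ge0.
Qed.

Lemma mixture_push_point_mass X (mu : measures X) :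
  mixture (push_measures (dirac_map X) mu) = mu.
Proof.
have [xi [pxi muE]] := measures_law mu; apply: eq_measures => A mA.
rewrite (mixture_pushE _ pxi muE mA) muE image_measureE//.
have mxiA : measurable (xi @^-1` A) by exact: plot0_preimage.
rewrite -[X in U X]setIT -integral_indic//; apply: eq_integral => w _.
exact: point_massE.
Qed.

(** If [zeta] samples X from three nested samples, both sides are its law
    under U, for the two bracketings of the three samples. *)
Lemma mixture_mixture X (Xi : measures (PX (PX X))) :
  mixture (mixture Xi) = mixture (push_measures (join_map X) Xi).
Proof.
have [Z [pZ XiE]] := measures_law Xi.
have [eta [peta etaE]] := plot0_measures pZ.
have ME : measure_val (mixture Xi) = image_measure eta U.
  have <- : law peta = mixture Xi.
    apply: eq_measures => A mA.
    rewrite (mixtureE pZ XiE mA) /= image_measureE// -fubini_Unif.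
      by apply: eq_integral => w _; rewrite etaE.
    exact: plot0_preimage.
  by [].
apply: eq_measures => A mA.
rewrite (mixtureE peta ME mA) (mixture_pushE _ pZ XiE mA).
have [zeta [pzeta zetaE]] := plot0_measures peta.
pose D : set Omega := zeta @^-1` A.
have mD : measurable D by exact: plot0_preimage.
have mrD := measurable_preimage (@measurable_reassociate R) mD.
transitivity (U D).
  by rewrite -(fubini_Unif mD); apply: eq_integral => w _; exact: zetaE.
rewrite -(Unif_reassociate mD) -(fubini_Unif mrD); apply: eq_integral => w _ /=.
have mw : measurable_fun [set: Omega] (fun w' => Theta_inv (w, w') : Omega).
  by apply: measurable_Theta_inv => //; exact: measurable_cst.
have Zw : measure_val (Z w : measures (PX X)) =
    image_measure (fun w' => eta (Theta_inv (w, w'))) U.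
  have <- : law (plot0_comp peta mw) = Z w.
    by apply: eq_measures => B mB; rewrite etaE// /= image_measureE.
  by [].
rewrite (mixtureE (plot0_comp peta mw) Zw mA).
have mE : measurable (slice (@reassociate R @^-1` D) w).
  exact: measurable_slice.
rewrite -(fubini_Unif mE); apply: eq_integral => w' _; rewrite /= zetaE//.
by congr (U _); apply/seteqP; split=> w'';
  rewrite /slice/= /reassociate !(theta1K, theta2K).
Qed.

Lemma plot0_pair X Y (xi : Omega -> X) (eta : Omega -> Y) :
  plot0 xi -> plot0 eta -> @plot0 R (sss_prod X Y) (fun w => (xi w, eta w)).
Proof. by split. Qed.

Lemma induced_sigma_xsection X Y (C : set (X * Y)) x :
  induced_sigma (sss_prod X Y) C -> induced_sigma Y [set y | C (x, y)].
Proof.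
by move=> mC; exact: induced_sigma_preimage (sss_funP (pair_map Y x)) mC.
Qed.

Lemma induced_sigma_ysection X Y (C : set (X * Y)) y :
  induced_sigma (sss_prod X Y) C -> induced_sigma X [set x | C (x, y)].
Proof.
move=> mC xi pxi; apply: (mC (fun w => (xi w, y))).
exact: plot0_pair pxi (plot0_cst y).
Qed.

Lemma tensor_mixture X Y (x : X) (Gamma : measures (PX Y)) :
  tensor (x, mixture Gamma) =
  mixture (push_measures (strength_map X Y) (@tensor R X (PX Y) (x, Gamma))).
Proof.
have [xi [pxi GE]] := measures_law Gamma; apply: eq_measures => C mC.
have mCx : induced_sigma Y [set y | C (x, y)] by exact: induced_sigma_xsection.
rewrite tensorE// (mixtureE pxi GE mCx).
have tE : measure_val (@tensor R X (PX Y) (x, Gamma)) =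
    image_measure (X := sss_prod X (PX Y)) (fun w => (x, xi w)) U.
  exact: (push_measures_law (pair_map (PX Y) x) GE).
rewrite (mixture_pushE _ (plot0_pair (plot0_cst x) pxi) tE mC).
by apply: eq_integral => w _; exact/esym/tensorE.
Qed.

(** [C] is a set of B_(X * Y), which need not be generated by rectangles; but
    its preimage under two independent random elements is a universally
    measurable subset of [Omega], to which [fubini_swap] applies. *)
Lemma fubini_pair X Y (xi : Omega -> X) (eta : Omega -> Y) C :
  plot0 xi -> plot0 eta -> induced_sigma (sss_prod X Y) C ->
  \int[U]_w U [set w' | C (xi w, eta w')] =
  \int[U]_w' U [set w | C (xi w, eta w')].
Proof.
move=> pxi peta mC.
pose D : set Omega := [set v | C (xi (theta1 v), eta (theta2 v))].
have mD : measurable D.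
  apply: (mC (fun v => (xi (theta1 v), eta (theta2 v)))); split.
    exact: (plot0_comp pxi (@measurable_theta1 R)).
  exact: (plot0_comp peta (@measurable_theta2 R)).
have := fubini_swap mD; rewrite /slice.
rewrite (_ : (fun w => U [set w' | D (Theta_inv (w, w'))]) =
  (fun w => U [set w' | C (xi w, eta w')])); last first.
  apply/funext => w; congr (U _).
  by apply/seteqP; split=> w'; rewrite /D/= theta1K theta2K.
move=> ->; apply: eq_integral => w' _; congr (U _).
by apply/seteqP; split=> w; rewrite /D/= theta1K theta2K.
Qed.

(** A random element [xi] with law [point_mass x] need not be almost surely
    equal to [x], as singletons need not be measurable. Integrating over it
    first, only its law matters. *)
Lemma tensor_is_product X Y (x : X) (nu : measures Y) :
  is_product_measure (point_mass x) nu (tensor (x, nu)).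
Proof.
split=> [|xi eta [pxi peta xE nuE] C mC].
  have [eta [peta nuE]] := measures_law nu.
  by exists (cst x), eta; split=> //; exact: plot0_cst.
have mCx x' : induced_sigma Y [set y | C (x', y)].
  exact: induced_sigma_xsection.
have mCy y : induced_sigma X [set x' | C (x', y)].
  exact: induced_sigma_ysection.
rewrite tensorE// nuE image_measureE//.
transitivity (\int[U]_w1 U [set w2 | C (xi w1, eta w2)]); last first.
  apply: eq_integral => w1 _.
  have m : measurable [set w2 | C (xi w1, eta w2)].
    exact: plot0_preimage peta (mCx (xi w1)).
  by rewrite -[RHS]/(\int[U]_w2 (\1_[set w2 | C (xi w1, eta w2)] w2)%:E)
    integral_indic// setIT.
rewrite fubini_pair//.
have mD : measurable [set w2 | C (x, eta w2)].
  exact: plot0_preimage peta (mCx x).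
rewrite -[X in U X]setIT -integral_indic//; apply: eq_integral => w2 _.
have := point_massE x (mCy (eta w2)); rewrite xE image_measureE// => ->.
Qed.

End laws.

(** * The monad *)

Section categorical.
Variable R : realType.
Local Notation Omega := (Omega R).
Local Notation U := (Unif R).

(** Transparent, as is the strength, since the formulas for the structure maps
    are read off from the components by conversion. *)
Definition measure_monad : @monad (SSS R) (@PX R).
Proof.
refine (@Monad (SSS R) (@PX R) (@Pmap R) (@dirac_map R) (@join_map R)
  _ _ _ _ _ _ _).
- move=> X; apply: sss_map_ext => mu; apply: eq_measures => A mA.
  exact: push_measuresE.
- move=> X Y Z g f; apply: sss_map_ext => mu; apply: eq_measures => A mA.
  have mgA := induced_sigma_preimage (sss_funP g) mA.
  by rewrite /= !image_measureE.
- move=> X Y f; apply: sss_map_ext => x; exact: push_measures_natural_point.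
- move=> X Y f; apply: sss_map_ext => Gamma; exact: mixture_natural.
- move=> X; apply: sss_map_ext => mu; exact: mixture_point_mass.
- move=> X; apply: sss_map_ext => mu; exact: mixture_push_point_mass.
- move=> X; apply: sss_map_ext => Xi; exact: mixture_mixture.
Defined.

Definition measure_strength : strength (SSS_cartesian R) measure_monad.
Proof.
refine (@Strength (SSS R) (SSS_cartesian R) (@PX R) measure_monad
  (@strength_map R) _ _ _ _ _).
- move=> X X' Y Y' f g; apply: sss_map_ext => -[x nu].
  apply: measures_val_inj; rewrite /= [LHS]image_measure_comp.
    by rewrite [RHS]image_measure_comp//; exact: (sss_funP (pair_map Y' (f x))).
  exact: (sss_funP (timesm (SSS_cartesian R) f g)).
- move=> X; apply: sss_map_ext => -[[] nu]; apply: eq_measures => C mC.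
  rewrite /= !image_measureE//.
  pose snd_map := psnd (SSS_cartesian R) (sss_one R) X.
  exact: (induced_sigma_preimage (sss_funP snd_map) mC).
- move=> X Y Z; apply: sss_map_ext => -[[x y] nu]; apply: measures_val_inj.
  rewrite /= [LHS]image_measure_comp.
    rewrite [RHS]image_measure_comp//.
    exact: (sss_funP (pair_map (sss_prod Y Z) x)).
  exact: (sss_funP (associator (SSS_cartesian R) X Y Z)).
- move=> X Y; apply: sss_map_ext => -[x y]; apply: measures_val_inj.
  rewrite /= image_measure_comp//; exact: (sss_funP (pair_map Y x)).
- move=> X Y; apply: sss_map_ext => -[x Gamma]; exact: tensor_mixture.
Defined.

Lemma costrengthE (X Y : sss R) (mu : measures X) (y : Y) C :
  induced_sigma (sss_prod X Y) C ->
  (costrength measure_strength X Y :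
    sss_map (sss_prod (PX X) Y) (PX (sss_prod X Y))) (mu, y) C =
  mu [set x | C (x, y)].
Proof.
move=> mC; have mbC := induced_sigma_preimage
  (sss_funP (braiding (SSS_cartesian R) Y X)) mC.
apply: etrans (push_measuresE (braiding (SSS_cartesian R) Y X)
  (tensor (y, mu)) mC) _.
exact: tensorE mbC.
Qed.

(** Sampling both measures, the two composites integrate the same indicator in
    the two orders. *)
Theorem measure_strength_commutative : commutative_strength measure_strength.
Proof.
move=> X Y; apply: sss_map_ext => -[mu nu]; apply: eq_measures => C mC.
have [xi [pxi muE]] := measures_law (mu : measures X).
have [eta [peta nuE]] := measures_law (nu : measures Y).
pose cost := costrength measure_strength X Y :
  sss_map (sss_prod (PX X) Y) (PX (sss_prod X Y)).
have mCx x : induced_sigma Y [set y | C (x, y)].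
  exact: induced_sigma_xsection.
have mCy y : induced_sigma X [set x | C (x, y)].
  exact: induced_sigma_ysection.
transitivity (\int[U]_w' U [set w | C (xi w, eta w')])%E.
  have tE : measure_val (@tensor R (PX X) Y (mu, nu)) =
      image_measure (X := sss_prod (PX X) Y) (fun w => (mu, eta w)) U.
    exact: (push_measures_law (pair_map Y (mu : PX X)) nuE).
  apply: etrans (mixture_pushE cost
    (plot0_pair (plot0_cst (mu : PX X)) peta) tE mC) _.
  apply: eq_integral => w' _; rewrite [LHS]costrengthE// muE image_measureE//.
have tE : measure_val ((costrength measure_strength X (PX Y) :
      sss_map (sss_prod (PX X) (PX Y)) (PX (sss_prod X (PX Y)))) (mu, nu)) =
    image_measure (X := sss_prod X (PX Y)) (fun w => (xi w, nu)) U.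
  apply: etrans (push_measures_law (braiding (SSS_cartesian R) (PX Y) X)
    (push_measures_law (pair_map X (nu : PX Y)) muE)) _.
  by [].
apply/esym.
apply: etrans (mixture_pushE (strength_map X Y)
  (plot0_pair pxi (plot0_cst (nu : PX Y))) tE mC) _.
rewrite -(fubini_pair pxi peta mC); apply: eq_integral => w _.
by rewrite [LHS]tensorE// nuE image_measureE.
Qed.

(** All random elements of the one-point space coincide. *)
Theorem measure_affine : affine (SSS_cartesian R) (@PX R).
Proof.
exists (bang (SSS_cartesian R) (PX (sss_one R))), (dirac_map (sss_one R)).
split; last by apply: sss_map_ext => -[].
apply: sss_map_ext => mu; apply: eq_measures => A mA.
have [xi [_ muE]] := measures_law mu.
rewrite [RHS](congr1 (fun m : set unit -> \bar R => m A) muE) image_measureE//.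
rewrite /= image_measureE//; congr (U _).
by apply/funext => w; rewrite /preimage/=; case: (xi w).
Qed.

End categorical.

Theorem theorem6p12 (R : realType) :
  exists PX_sss : forall X : sss R, sample_smooth (measures_plotted X),
  let P (X : SSS R) : SSS R := Sss (PX_sss X) in
  exists (m : monad P) (tau : strength (SSS_cartesian R) m),
  [/\ (* P(f)(mu) = f_* mu *)
      forall (X Y : sss R) (f : sss_map X Y) (mu : measures X) (A : set Y),
        induced_sigma Y A ->
        (monad_map m f : sss_map (P X) (P Y)) mu A = mu (f @^-1` A),
      (* delta_X(x) = delta_x *)
      forall (X : sss R) (x : X) (A : set X), induced_sigma X A ->
        (unitm m X : sss_map X (P X)) x A = (\1_A x)%:E,
      (* M_X(Gamma)(A) = \int nu(A) Gamma(dnu) *)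
      forall (X : sss R) (Gamma : measures (P X)) (nu0 : P X) (A : set X),
        induced_sigma X A ->
        (joinm m X : sss_map (P (P X)) (P X)) Gamma A =
        (\int[(Gamma : set (induced_space nu0) -> \bar R)]_nu (nu : measures X) A)%E
    & (* tau_{X,Y}(x, nu) = delta_x (x) nu *)
      forall (X Y : sss R) (x : X) (nu : measures Y),
        is_product_measure ((unitm m X : sss_map X (P X)) x) nu
          ((st tau X Y : sss_map (sss_prod X (P Y)) (P (sss_prod X Y)))
             (x, nu)) ] /\
  commutative_strength tau /\ affine (SSS_cartesian R) P.
Proof.
exists (@measures_sample_smooth R), (measure_monad R), (measure_strength R).
split; last first.
  by split; [exact: measure_strength_commutative|exact: measure_affine].
split.
- by move=> X Y f mu A mA; exact: push_measuresE.
- by move=> X x A mA; exact: point_massE.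
- move=> X Gamma nu0 A mA; have [xi [pxi GE]] := measures_law Gamma.
  by rewrite (integral_eval _ pxi GE mA); exact: mixtureE pxi GE mA.
- by move=> X Y x nu; exact: tensor_is_product.
Qed.
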